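(* Let $n\ge2$ and let $q\in\mathbb{C}^\times$ be not a root of unity. Let $\mathbb{H}_n$ be the $GL_n$-type double affine Hecke algebra over $\mathbb{C}(\tau)$, let $\mathfrak{A}\subset\mathbb{H}_n$ be the subalgebra generated by $X_1,\dots,X_n$, $D_1,\dots,D_n$, $Y_1^{\pm1},\dots,Y_n^{\pm1}$ and $T_1,\dots,T_{n-1}$, let $\mathbb{H}^{\mathfrak{gl}_n}\subset\mathfrak{A}$ be the subalgebra generated by $T_k$, $Y_i^{\pm1}$ and $e_{ij}=X_iD_j$ ($i\ne j$), and let $\widetilde Y=\prod_{i=1}^nY_i$. Then $$C_{\mathfrak{A}}(\widetilde Y)=\mathbb{H}^{\mathfrak{gl}_n}\qquad\text{and}\qquad C_{\mathfrak{A}}(\mathbb{H}^{\mathfrak{gl}_n})=\mathcal{Z}(\mathbb{H}^{\mathfrak{gl}_n}),$$ where $C_{\mathfrak{A}}(\cdot)$ denotes the centraliser in $\mathfrak{A}$ and $\mathcal{Z}$ the centre.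
   Context: $\mathbb{H}_n$ is the unital associative algebra over $\mathbb{C}(\tau)$ ($\tau$ a formal variable) generated by $T_k$ ($1\le k\le n-1$), $X_i^{\pm1}$, $Y_i^{\pm1}$ ($1\le i\le n$) with relations: $(T_k-\tau)(T_k+\tau^{-1})=0$; $T_lT_{l+1}T_l=T_{l+1}T_lT_{l+1}$ ($1\le l\le n-2$); $[T_k,T_l]=0$ if $|k-l|>1$; $T_kX_kT_k=X_{k+1}$, $[T_k,X_i]=0$ for $i\ne k,k+1$; $T_k^{-1}Y_kT_k^{-1}=Y_{k+1}$, $[T_k,Y_i]=0$ for $i\neq k,k+1$; $\widetilde Y X_i=qX_i\widetilde Y$ with $\widetilde Y=\prod_{i=1}^nY_i$; $Y_2^{-1}X_1Y_2X_1^{-1}=T_1^2$; the $X_i^{\pm1}$ are mutually inverse and commute with each other, and likewise the $Y_i^{\pm1}$. $D_n=(q-q^{-1})^{-1}X_n^{-1}(Y_n-Y_n^{-1})$ and, for $1\le i\le n-1$, $D_i=T_iT_{i+1}\cdots T_{n-1}\,D_n\,T_{n-1}\cdots T_{i+1}T_i$. $C_A(B)=\{a\in A: ab=ba \text{ for all } b\in B\}$. *)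

(* Defs.v *)
From HB Require Import structures.
From mathcomp Require Import all_boot all_order all_algebra.
From mathcomp Require Import generic_quotient fraction.
From mathcomp Require Import boolp classical_sets reals complex.

Set Implicit Arguments.
Unset Strict Implicit.
Unset Printing Implicit Defensive.

Import GRing.Theory Num.Theory.

Local Open Scope ring_scope.
Local Open Scope quotient_scope.
Local Open Scope classical_set_scope.

(******************************************************************************)
(* Unital associative algebras given by generators and relations.             *)
(*                                                                            *)
(* ncexpr F G == noncommutative polynomial expressions with coefficients in   *)
(*               the field F and letters in G                                 *)
(*   pcong r  == the smallest congruence on ncexpr F G containing r and the   *)
(*               axioms of unital associative F-algebras                      *)
(*   palg r   == the quotient of ncexpr F G by pcong r, i.e., the F-algebra   *)
(*               with generators G and relations s = t for r s t              *)
(*                                                                            *)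
(* MathComp's lalgType/algType require 1 != 0, which for a presented algebra  *)
(* is a theorem and not part of the construction; palg r is therefore         *)
(* equipped with pzRingType and lmodType F structures instead.                *)
(******************************************************************************)

Inductive ncexpr (F G : Type) : Type :=
  | NCGen of G
  | NCConst of F
  | NCAdd of ncexpr F G & ncexpr F G
  | NCMul of ncexpr F G & ncexpr F G.

Arguments NCGen {F G} _.
Arguments NCConst {F G} _.

HB.instance Definition _ (F G : Type) := gen_eqMixin (ncexpr F G).
HB.instance Definition _ (F G : Type) := gen_choiceMixin (ncexpr F G).

Declare Scope ncexpr_scope.
Delimit Scope ncexpr_scope with NC.
Bind Scope ncexpr_scope with ncexpr.
Notation "s + t" := (NCAdd s t) : ncexpr_scope.
Notation "s * t" := (NCMul s t) : ncexpr_scope.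
Notation "s - t" := (NCAdd s (NCMul (NCConst (-1)%R) t)) : ncexpr_scope.
Notation "c %:T" := (NCConst c%R) : ncexpr_scope.

Section Presentation.
Variables (F : fieldType) (G : Type).
Local Notation ncexpr := (ncexpr F G).

Inductive pcong (r : ncexpr -> ncexpr -> Prop) : ncexpr -> ncexpr -> Prop :=
  | pc_rel s t : r s t -> pcong r s t
  | pc_refl s : pcong r s s
  | pc_sym s t : pcong r s t -> pcong r t s
  | pc_trans t s u : pcong r s t -> pcong r t u -> pcong r s u
  | pc_add s s' t t' :
      pcong r s s' -> pcong r t t' -> pcong r (s + t)%NC (s' + t')%NC
  | pc_mul s s' t t' :
      pcong r s s' -> pcong r t t' -> pcong r (s * t)%NC (s' * t')%NC
  | pc_addA s t u : pcong r (s + (t + u))%NC (s + t + u)%NC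
  | pc_addC s t : pcong r (s + t)%NC (t + s)%NC
  | pc_add0 s : pcong r (0%:T + s)%NC s
  | pc_addN s : pcong r ((-1)%:T * s + s)%NC 0%:T%NC
  | pc_mulA s t u : pcong r (s * (t * u))%NC (s * t * u)%NC
  | pc_mul1 s : pcong r (1%:T * s)%NC s
  | pc_mulDl s t u : pcong r ((s + t) * u)%NC (s * u + t * u)%NC
  | pc_mulDr s t u : pcong r (s * (t + u))%NC (s * t + s * u)%NC
  | pc_constD a b : pcong r (a + b)%:T%NC (a%:T + b%:T)%NC
  | pc_constM a b : pcong r (a * b)%:T%NC (a%:T * b%:T)%NC
  | pc_constC a s : pcong r (a%:T * s)%NC (s * a%:T)%NC.

Variable r : ncexpr -> ncexpr -> Prop.

Definition pcongb (s t : ncexpr) : bool := `[< pcong r s t >].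

Lemma pcongb_refl : reflexive pcongb.
Proof. by move=> s; apply/asboolP; exact: pc_refl. Qed.

Lemma pcongb_sym : symmetric pcongb.
Proof. by move=> s t; apply: asbool_equiv_eq; split; exact: pc_sym. Qed.

Lemma pcongb_trans : transitive pcongb.
Proof.
by move=> t s u /asboolP st /asboolP tu; apply/asboolP; exact: pc_trans st tu.
Qed.

Canonical pcong_equiv := EquivRel pcongb pcongb_refl pcongb_sym pcongb_trans.

Definition palg : Type := {eq_quot pcong_equiv}.
HB.instance Definition _ := Choice.on palg.

Definition pi_palg (t : ncexpr) : palg := \pi_({eq_quot pcong_equiv}) t.

Lemma pi_palgP s t : pi_palg s = pi_palg t <-> pcong r s t.
Proof. by split=> [/eqmodP/asboolP|st] //; apply/eqmodP/asboolP. Qed.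

Definition repr_palg (x : palg) : ncexpr := repr (x : {eq_quot pcong_equiv}).

Lemma repr_palgK : cancel repr_palg pi_palg.
Proof. by move=> x; rewrite /pi_palg /repr_palg reprK. Qed.

Lemma pcong_repr t : pcong r (repr_palg (pi_palg t)) t.
Proof. by apply/pi_palgP; rewrite repr_palgK. Qed.

Lemma palg_ind (P : palg -> Prop) : (forall t, P (pi_palg t)) -> forall x, P x.
Proof. by move=> Pt x; rewrite -(repr_palgK x). Qed.

Definition palg_add (x y : palg) := pi_palg (repr_palg x + repr_palg y)%NC.
Definition palg_mul (x y : palg) := pi_palg (repr_palg x * repr_palg y)%NC.
Definition palg_opp (x : palg) := pi_palg ((-1)%:T * repr_palg x)%NC.
Definition palg_scale (a : F) (x : palg) := pi_palg (a%:T * repr_palg x)%NC.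

Lemma pi_add s t : pi_palg (s + t)%NC = palg_add (pi_palg s) (pi_palg t).
Proof. by apply/pi_palgP; apply: pc_add; apply/pc_sym/pcong_repr. Qed.

Lemma pi_mul s t : pi_palg (s * t)%NC = palg_mul (pi_palg s) (pi_palg t).
Proof. by apply/pi_palgP; apply: pc_mul; apply/pc_sym/pcong_repr. Qed.

Lemma pi_opp t : pi_palg ((-1)%:T * t)%NC = palg_opp (pi_palg t).
Proof.
by apply/pi_palgP/pc_mul; [exact: pc_refl|apply/pc_sym/pcong_repr].
Qed.

Lemma pi_scale a t : pi_palg (a%:T * t)%NC = palg_scale a (pi_palg t).
Proof.
by apply/pi_palgP/pc_mul; [exact: pc_refl|apply/pc_sym/pcong_repr].
Qed.

Let addA : associative palg_add.
Proof.
elim/palg_ind=> s; elim/palg_ind=> t; elim/palg_ind=> u.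
by rewrite -!pi_add; apply/pi_palgP/pc_addA.
Qed.

Let addC : commutative palg_add.
Proof.
elim/palg_ind=> s; elim/palg_ind=> t.
by rewrite -!pi_add; apply/pi_palgP/pc_addC.
Qed.

Let add0 : left_id (pi_palg 0%:T) palg_add.
Proof. by elim/palg_ind=> s; rewrite -!pi_add; apply/pi_palgP/pc_add0. Qed.

Let addN : left_inverse (pi_palg 0%:T) palg_opp palg_add.
Proof.
by elim/palg_ind=> s; rewrite -!pi_opp -pi_add; apply/pi_palgP/pc_addN.
Qed.

HB.instance Definition _ := GRing.isZmodule.Build palg addA addC add0 addN.

Let mulA : associative palg_mul.
Proof.
elim/palg_ind=> s; elim/palg_ind=> t; elim/palg_ind=> u.
by rewrite -!pi_mul; apply/pi_palgP/pc_mulA.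
Qed.

Let mul1 : left_id (pi_palg 1%:T) palg_mul.
Proof. by elim/palg_ind=> s; rewrite -!pi_mul; apply/pi_palgP/pc_mul1. Qed.

Let mulx1 : right_id (pi_palg 1%:T) palg_mul.
Proof.
elim/palg_ind=> s; rewrite -!pi_mul; apply/pi_palgP.
by apply: pc_trans (pc_sym (pc_constC _ _ _)) (pc_mul1 _ _).
Qed.

Let mulDl : left_distributive palg_mul palg_add.
Proof.
elim/palg_ind=> s; elim/palg_ind=> t; elim/palg_ind=> u.
by rewrite -!(pi_add, pi_mul); apply/pi_palgP/pc_mulDl.
Qed.

Let mulDr : right_distributive palg_mul palg_add.
Proof.
elim/palg_ind=> s; elim/palg_ind=> t; elim/palg_ind=> u.
by rewrite -!(pi_add, pi_mul); apply/pi_palgP/pc_mulDr.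
Qed.

HB.instance Definition _ :=
  GRing.Zmodule_isPzRing.Build palg mulA mul1 mulx1 mulDl mulDr.

Let scaleA a b x : palg_scale a (palg_scale b x) = palg_scale (a * b) x.
Proof.
elim/palg_ind: x => s; rewrite -!pi_scale; apply/pi_palgP.
apply: pc_trans (pc_mulA _ _ _ _) _.
by apply: pc_mul (pc_sym (pc_constM _ _ _)) (pc_refl _ _).
Qed.

Let scale1 : left_id 1 palg_scale.
Proof. by elim/palg_ind=> s; rewrite -pi_scale; apply/pi_palgP/pc_mul1. Qed.

Let scaleDr : right_distributive palg_scale +%R.
Proof.
move=> a; elim/palg_ind=> s; elim/palg_ind=> t.
rewrite -[_ + pi_palg t]pi_add -!pi_scale -[RHS]pi_add.
exact/pi_palgP/pc_mulDr.
Qed.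

Let scaleDl x : {morph palg_scale^~ x : a b / a + b}.
Proof.
elim/palg_ind: x => s a b; rewrite -!pi_scale -[RHS]pi_add; apply/pi_palgP.
apply: pc_trans (pc_mulDl _ _ _ _).
by apply: pc_mul (pc_constD _ _ _) (pc_refl _ _).
Qed.

HB.instance Definition _ :=
  GRing.Zmodule_isLmodule.Build F palg scaleA scale1 scaleDr scaleDl.

Lemma palg_relP s t : r s t -> pi_palg s = pi_palg t.
Proof. by move=> rst; apply/pi_palgP/pc_rel. Qed.

Lemma pi_palgD s t : pi_palg (s + t)%NC = pi_palg s + pi_palg t.
Proof. exact: pi_add. Qed.

Lemma pi_palgM s t : pi_palg (s * t)%NC = pi_palg s * pi_palg t.
Proof. exact: pi_mul. Qed.

Lemma pi_palgZ a t : pi_palg (a%:T * t)%NC = a *: pi_palg t.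
Proof. exact: pi_scale. Qed.

Lemma pi_palgC a : pi_palg a%:T%NC = a *: (1 : palg).
Proof.
rewrite -[LHS]mulr1 -pi_palgM -pi_palgZ; apply/pi_palgP; exact: pc_refl.
Qed.

Lemma pi_palgB s t : pi_palg (s - t)%NC = pi_palg s - pi_palg t.
Proof. by rewrite pi_palgD pi_palgZ scaleN1r. Qed.

Lemma scale_palgAl (a : F) (x y : palg) : a *: (x * y) = a *: x * y.
Proof.
elim/palg_ind: x => s; elim/palg_ind: y => t.
rewrite -pi_palgM -!pi_palgZ -pi_palgM; exact/pi_palgP/pc_mulA.
Qed.

Lemma scale_palgAr (a : F) (x y : palg) : a *: (x * y) = x * (a *: y).
Proof.
elim/palg_ind: x => s; elim/palg_ind: y => t.
rewrite -pi_palgM -!pi_palgZ -pi_palgM; apply/pi_palgP.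
apply: pc_trans (pc_mulA _ _ _ _) _.
apply: pc_trans (pc_sym (pc_mulA _ _ _ _)).
by apply: pc_mul (pc_constC _ _ _) (pc_refl _ _).
Qed.

(* The universal property. An F-algebra is given here as a ring A with a      *)
(* ring morphism c from F to its centre.                                      *)

Fixpoint nceval (A : pzRingType) (c : F -> A) (v : G -> A) (t : ncexpr) : A :=
  match t with
  | NCGen g => v g
  | NCConst a => c a
  | NCAdd s t => nceval c v s + nceval c v t
  | NCMul s t => nceval c v s * nceval c v t
  end.

Lemma palg_universal (A : pzRingType) (c : {rmorphism F -> A}) (v : G -> A) :
    (forall a x, c a * x = x * c a) ->
    (forall s t, r s t -> nceval c v s = nceval c v t) ->
  exists! f : palg -> A,
    [/\ forall x y, f (x + y) = f x + f y, forall x y, f (x * y) = f x * f y,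
        forall a, f (a *: (1 : palg)) = c a & forall g, f (pi_palg (NCGen g)) = v g].
Proof.
move=> cC cr.
have cP s t : pcong r s t -> nceval c v s = nceval c v t.
  elim=> {s t} //=; do ?[by move=> *; congruence]; move=> *;
  rewrite ?(addrA, mulrA, rmorphN, rmorphD, rmorphM, rmorph1, rmorph0, add0r,
            mulN1r, addNr, mul1r, mulrDl, mulrDr) //.
  by rewrite addrC.
pose f (x : palg) := nceval c v (repr_palg x).
have fpi t : f (pi_palg t) = nceval c v t by apply/cP/pcong_repr.
exists f; split.
  split=> [||a|g]; last by rewrite fpi.
  - by elim/palg_ind=> s; elim/palg_ind=> t; rewrite -pi_palgD !fpi.
  - by elim/palg_ind=> s; elim/palg_ind=> t; rewrite -pi_palgM !fpi.
  - by rewrite -pi_palgC fpi.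
move=> h [hD hM hC hG]; apply/funext; elim/palg_ind=> t; rewrite fpi.
elim: t => [g|a|s IHs t IHt|s IHs t IHt] /=.
- by rewrite hG.
- by rewrite pi_palgC hC.
- by rewrite pi_palgD hD IHs IHt.
- by rewrite pi_palgM hM IHs IHt.
Qed.

Definition is_subalg (S : set palg) : Prop :=
  [/\ S 1, forall a x y, S x -> S y -> S (a *: x + y)
         & forall x y, S x -> S y -> S (x * y)].

Definition subalg_gen (B : set palg) : set palg := smallest is_subalg B.

End Presentation.

Arguments pi_palg {F G} r t.

Definition centraliser (A : pzRingType) (S B : set A) : set A :=
  [set a | S a /\ forall b, B b -> a * b = b * a].

Definition centre (A : pzRingType) (S : set A) : set A := centraliser S S.

(******************************************************************************)
(* The GL_n double affine Hecke algebra.                                      *)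
(*                                                                            *)
(* Indices start at 0: for k : 'I_n.-1 and i : 'I_n, the letters T_k, X_i,    *)
(* Y_i below are T_(k+1), X_(i+1), Y_(i+1) in the usual numbering; in         *)
(* particular T_k relates X_k to X_(k+1).                                     *)
(******************************************************************************)

Inductive daha_gen (n : nat) : Type :=
  | GenT of 'I_n.-1
  | GenX of 'I_n
  | GenXV of 'I_n
  | GenY of 'I_n
  | GenYV of 'I_n.

Section DAHA.
Variables (R : realType) (n : nat) (q : R[i]).

Definition Ctau : fieldType := {fraction {poly R[i]}}.
Definition tau : Ctau := tofrac 'X.
Definition qC : Ctau := tofrac q%:P.

Section Relations.
Local Open Scope ncexpr_scope.
Local Notation ncexpr := (ncexpr Ctau (daha_gen n)).
Local Notation T k := (NCGen (GenT k) : ncexpr).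
Local Notation X i := (NCGen (GenX i) : ncexpr).
Local Notation XV i := (NCGen (GenXV i) : ncexpr).
Local Notation Y i := (NCGen (GenY i) : ncexpr).
Local Notation YV i := (NCGen (GenYV i) : ncexpr).

(* T_k^-1, as forced by the quadratic relation; see dahaTTV and dahaTVT below *)
Local Notation TV k := (T k - (tau - tau^-1)%:T).

Local Notation Yprod :=
  (\big[@NCMul Ctau (daha_gen n)/NCConst 1%R]_(i < n) Y i).

Inductive daha_rel : ncexpr -> ncexpr -> Prop :=
  | dr_hecke (k : 'I_n.-1) :
      daha_rel ((T k - tau%:T) * (T k + (tau^-1)%:T)) 0%:T
  | dr_braid (k l : 'I_n.-1) : l = k.+1 :> nat ->
      daha_rel (T k * T l * T k) (T l * T k * T l)
  | dr_TT (k l : 'I_n.-1) :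
      ((k.+1 < l) || (l.+1 < k))%N -> daha_rel (T k * T l) (T l * T k)
  | dr_TXT (k : 'I_n.-1) (i j : 'I_n) : i = k :> nat -> j = k.+1 :> nat ->
      daha_rel (T k * X i * T k) (X j)
  | dr_TX (k : 'I_n.-1) (i : 'I_n) : i != k :> nat -> i != k.+1 :> nat ->
      daha_rel (T k * X i) (X i * T k)
  | dr_TYT (k : 'I_n.-1) (i j : 'I_n) : i = k :> nat -> j = k.+1 :> nat ->
      daha_rel (TV k * Y i * TV k) (Y j)
  | dr_TY (k : 'I_n.-1) (i : 'I_n) : i != k :> nat -> i != k.+1 :> nat ->
      daha_rel (T k * Y i) (Y i * T k)
  | dr_YprodX (i : 'I_n) : daha_rel (Yprod * X i) (qC%:T * X i * Yprod)
  | dr_YXYX (k : 'I_n.-1) (i j : 'I_n) :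
      k = 0%N :> nat -> i = 0%N :> nat -> j = 1%N :> nat ->
      daha_rel (YV j * X i * Y j * XV i) (T k * T k)
  | dr_XXV (i : 'I_n) : daha_rel (X i * XV i) 1%:T
  | dr_XVX (i : 'I_n) : daha_rel (XV i * X i) 1%:T
  | dr_XX (i j : 'I_n) : daha_rel (X i * X j) (X j * X i)
  | dr_XcXV (i j : 'I_n) : daha_rel (X i * XV j) (XV j * X i)
  | dr_XVXV (i j : 'I_n) : daha_rel (XV i * XV j) (XV j * XV i)
  | dr_YYV (i : 'I_n) : daha_rel (Y i * YV i) 1%:T
  | dr_YVY (i : 'I_n) : daha_rel (YV i * Y i) 1%:T
  | dr_YY (i j : 'I_n) : daha_rel (Y i * Y j) (Y j * Y i)
  | dr_YcYV (i j : 'I_n) : daha_rel (Y i * YV j) (YV j * Y i)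
  | dr_YVYV (i j : 'I_n) : daha_rel (YV i * YV j) (YV j * YV i).

End Relations.

Definition daha : Type := palg daha_rel.
HB.instance Definition _ := GRing.PzRing.on daha.
HB.instance Definition _ := GRing.Lmodule.on daha.

Definition dahaT (k : 'I_n.-1) : daha := pi_palg daha_rel (NCGen (GenT k)).
Definition dahaX (i : 'I_n) : daha := pi_palg daha_rel (NCGen (GenX i)).
Definition dahaXV (i : 'I_n) : daha := pi_palg daha_rel (NCGen (GenXV i)).
Definition dahaY (i : 'I_n) : daha := pi_palg daha_rel (NCGen (GenY i)).
Definition dahaYV (i : 'I_n) : daha := pi_palg daha_rel (NCGen (GenYV i)).

Definition dahaTV (k : 'I_n.-1) : daha := dahaT k - (tau - tau^-1) *: (1 : daha).

Lemma tau_neq0 : tau != 0.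
Proof. by rewrite tofrac_eq0 polyX_eq0. Qed.

Lemma daha_hecke k :
  (dahaT k - tau *: (1 : daha)) * (dahaT k + tau^-1 *: (1 : daha)) = 0.
Proof.
have := palg_relP (dr_hecke k).
by rewrite pi_palgM pi_palgB pi_palgD !pi_palgC scale0r.
Qed.

Lemma daha_sq k : dahaT k * dahaT k = 1 + (tau - tau^-1) *: dahaT k.
Proof.
have := daha_hecke k; rewrite mulrDr !mulrBl -!scale_palgAl -!scale_palgAr.
rewrite !mul1r mulr1 scalerA divff ?tau_neq0 // scale1r scalerBl.
set a := dahaT k * _; set b := _ *: _; set c := _ *: _.
move=> /eqP; rewrite addrA subr_eq0 => /eqP <-.
by rewrite -!addrA [c + _]addrC !addrA addrNK subrK.
Qed.

Lemma dahaTTV k : dahaT k * dahaTV k = 1.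
Proof. by rewrite /dahaTV mulrBr -scale_palgAr mulr1 daha_sq addrK. Qed.

Lemma dahaTVT k : dahaTV k * dahaT k = 1.
Proof. by rewrite /dahaTV mulrBl -scale_palgAl mul1r daha_sq addrK. Qed.

Definition dahaYtilde : daha := \prod_(i < n) dahaY i.

(* For i : 'I_n, last_ord i is the largest element n.-1 of 'I_n; the argument *)
(* i only witnesses that 'I_n is inhabited.                                   *)
Definition last_ord (i : 'I_n) : 'I_n := insubd i n.-1.

Lemma last_ordE i : last_ord i = n.-1 :> nat.
Proof. by rewrite /last_ord val_insubd prednK ?leqnn //; case: n i => [[]|]. Qed.

Definition dahaDlast (l : 'I_n) : daha :=
  (qC - qC^-1)^-1 *: (dahaXV l * (dahaY l - dahaYV l)).

(* The left product is T_i ... T_(n-2) and the right one T_(n-2) ... T_i,     *)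
(* as rev_ord k = n - 2 - k; both are empty if i is the last index.           *)
Definition dahaD (i : 'I_n) : daha :=
  (\prod_(k < n.-1 | (i <= k)%N) dahaT k) * dahaDlast (last_ord i) *
  (\prod_(k < n.-1 | (i <= rev_ord k)%N) dahaT (rev_ord k)).

Definition frakA : set daha :=
  subalg_gen (range dahaX `|` range dahaD `|` range dahaY `|` range dahaYV `|`
              range dahaT).

Definition Hgl : set daha :=
  subalg_gen (range dahaT `|` range dahaY `|` range dahaYV `|`
              [set x | exists i j, i != j /\ x = dahaX i * dahaD j]).

End DAHA.

Arguments daha {R} n q.
Arguments dahaYtilde {R} n q.
Arguments frakA {R} n q _.
Arguments Hgl {R} n q _.

(* Main.v *)
Require Import Defs.
From mathcomp Require Import all_boot all_order all_algebra zify.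
From mathcomp Require Import boolp classical_sets reals complex.

Import GRing.Theory Num.Theory.
Local Open Scope ring_scope.
Local Open Scope classical_set_scope.

Set Implicit Arguments.
Unset Strict Implicit.
Unset Printing Implicit Defensive.

(**
Conjugation by Ytilde multiplies X_i by q, D_i by q^-1 and fixes T_k and Y_i;
as q is not a root of unity, eigenvectors for distinct powers of q are linearly
independent, so everything reduces to writing frakA as a sum of q^d-eigenspaces
whose degree 0 part is Hgl.  No basis theorem is needed.

Let K be generated by the T_k and Y_i^{+-1}, and D = D_n.  The relations give
V := K X_1 K = sum_i K X_i = sum_i X_i K.  Since D commutes with T_k for
k < n - 1, both V W and W V, where W := K D K, reduce modulo K to X_1 D and
D X_1, and the commutator [X_1, D] lies in K.  Hence K + V W = K + W V is in
Hgl, which implies Hgl V <= V Hgl and Hgl W <= W Hgl, and frakA is the sum of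
the spaces V^d Hgl and W^d Hgl.  Finally Ytilde is in Hgl, so the centraliser
of Hgl is contained in that of Ytilde, which is Hgl.
*)

(** * Additive spans of products of two sets *)

Section ProductSpan.
Variable A : pzRingType.
Implicit Types (P Q S : set A) (x y : A).

Inductive mulspan P Q : set A :=
  | mulspan0 : mulspan P Q 0
  | mulspanD x y : mulspan P Q x -> mulspan P Q y -> mulspan P Q (x + y)
  | mulspanM x y : P x -> Q y -> mulspan P Q (x * y).

Record subring_set S : Prop := SubringSet {
  subring1 : S 1;
  subringD x y : S x -> S y -> S (x + y);
  subringN x : S x -> S (- x);
  subringM x y : S x -> S y -> S (x * y) }.

Lemma subring0 S : subring_set S -> S 0.
Proof.
by case=> S1 SD SN _; rewrite -(subrr 1); apply: SD => //; apply: SN.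
Qed.

Lemma subringB S x y : subring_set S -> S x -> S y -> S (x - y).
Proof. by case=> ? D N ? ? ?; apply: D => //; apply: N. Qed.

Lemma mulspanMl P Q a x :
  (forall y, P y -> P (a * y)) -> mulspan P Q x -> mulspan P Q (a * x).
Proof.
move=> aP; elim=> [|{}x y _ + _|{}x y Px Qy].
- rewrite mulr0; exact: mulspan0.
- by rewrite mulrDr; exact: mulspanD.
- by rewrite mulrA; apply: mulspanM => //; exact: aP.
Qed.

Lemma mulspanMr P Q a x :
  (forall y, Q y -> Q (y * a)) -> mulspan P Q x -> mulspan P Q (x * a).
Proof.
move=> aQ; elim=> [|{}x y _ + _|{}x y Px Qy].
- rewrite mul0r; exact: mulspan0.
- by rewrite mulrDl; exact: mulspanD.
- by rewrite -mulrA; apply: mulspanM => //; exact: aQ.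
Qed.

Lemma mulspan_sub P Q S : S 0 -> (forall x y, S x -> S y -> S (x + y)) ->
  (forall x y, P x -> Q y -> S (x * y)) -> forall x, mulspan P Q x -> S x.
Proof.
move=> S0 SD SM x.
by elim=> [|{}x y _ ? _ ?|{}x y ? ?]; [exact: S0|exact: SD|exact: SM].
Qed.

Definition addset (K S : set A) : set A := [set x | exists2 k, K k & S (x - k)].

End ProductSpan.

(* Generators are indexed from 0, so that T k is meant for k < N and X i, Y i *)
(* for i <= N, where N + 1 is the rank.                                       *)
Record daha_relations (A : pzRingType) (N : nat) (c q qV : A)
    (T TV X XV Y YV : nat -> A) : Prop := DahaRelations {
  central_c x : c * x = x * c;
  central_q x : q * x = x * q;
  central_qV x : qV * x = x * qV;
  qqV : q * qV = 1;
  TTV k : (k < N)%N -> T k * TV k = 1;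
  TVT k : (k < N)%N -> TV k * T k = 1;
  TVE k : (k < N)%N -> TV k = T k - c;
  TXT k : (k < N)%N -> T k * X k * T k = X k.+1;
  TX k i : (k < N)%N -> (i <= N)%N -> i <> k -> i <> k.+1 ->
    T k * X i = X i * T k;
  XXV i : (i <= N)%N -> X i * XV i = 1;
  XVX i : (i <= N)%N -> XV i * X i = 1;
  XX i j : (i <= N)%N -> (j <= N)%N -> X i * X j = X j * X i;
  TYT k : (k < N)%N -> T k * Y k.+1 * T k = Y k;
  TY k i : (k < N)%N -> (i <= N)%N -> i <> k -> i <> k.+1 ->
    T k * Y i = Y i * T k;
  YYV i : (i <= N)%N -> Y i * YV i = 1;
  YVY i : (i <= N)%N -> YV i * Y i = 1;
  YY i j : (i <= N)%N -> (j <= N)%N -> Y i * Y j = Y j * Y i;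
  YprodX i : (i <= N)%N ->
    (\prod_(j < N.+1) Y j) * X i = q * X i * \prod_(j < N.+1) Y j;
  X0Y1 : X 0%N * Y 1%N = Y 1%N * T 0%N * T 0%N * X 0%N }.

(** * Moving [T k] past the other generators and past [Yt] *)

Section Relations.
Variables (A : pzRingType) (M : nat) (c q qV : A) (T TV X XV Y YV : nat -> A).
Local Notation N := M.+1.
Hypothesis rel : daha_relations N c q qV T TV X XV Y YV.
Implicit Types (i j k : nat) (a b x y : A).

Let Yt := \prod_(j < N.+1) Y j.

Lemma mulTTV k x : (k < N)%N -> x * T k * TV k = x.
Proof. by move=> kN; rewrite -mulrA (TTV rel) // mulr1. Qed.

Lemma mulTVT k x : (k < N)%N -> x * TV k * T k = x.
Proof. by move=> kN; rewrite -mulrA (TVT rel) // mulr1. Qed.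

Lemma commV a b bV :
  b * bV = 1 -> bV * b = 1 -> a * b = b * a -> a * bV = bV * a.
Proof.
move=> bbV bVb ab; rewrite -[a * bV]mul1r -bVb -!mulrA [b * (a * _)]mulrA -ab.
by rewrite -mulrA bbV mulr1.
Qed.

Lemma invU a b a' : a' * a = 1 -> a * b = 1 -> a' = b.
Proof. by move=> ea eb; rewrite -[a']mulr1 -eb mulrA ea mul1r. Qed.

(** The pairs [(X k, X k.+1)], [(XV k.+1, XV k)], [(Y k.+1, Y k)] and [(YV k, YV k.+1)] all have
    this shape, so the rules for moving [T k] past them are derived once. *)
Definition swaps k a b := T k * a * T k = b.

Section Swaps.
Variables (k : nat) (a b : A) (kN : (k < N)%N) (ab : swaps k a b).

Lemma swaps_Ta : T k * a = b * TV k.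
Proof. by rewrite -ab mulTTV. Qed.

Lemma swaps_aT : a * T k = TV k * b.
Proof. by rewrite -ab !mulrA (TVT rel) // mul1r. Qed.

Lemma T_sqE : T k * T k = 1 + c * T k.
Proof.
have := TTV rel kN; rewrite (TVE rel) // mulrBr => <-.
by rewrite (central_c rel) subrK.
Qed.

Lemma swaps_Tb : T k * b = a * T k + c * b.
Proof.
by rewrite -ab !mulrA T_sqE 2!mulrDl mul1r.
Qed.

Lemma swaps_bT : b * T k = T k * a + c * b.
Proof.
by rewrite -ab -mulrA T_sqE mulrDr mulr1 !mulrA -(central_c rel) !mulrA.
Qed.

(** Inverting $TaT=b$ gives $b^{-1}=T^{-1}a^{-1}T^{-1}$, so passing to inverses reverses the
    direction of a swap. *)
Lemma swapsV aV bV : a * aV = 1 -> aV * a = 1 -> bV * b = 1 -> swaps k bV aV.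
Proof.
move=> aaV aVa bVb; rewrite /swaps.
have ba : b = T k * a * T k by [].
suff -> : bV = TV k * aV * TV k.
  by rewrite !mulrA (TTV rel) // mul1r mulTVT.
apply: (invU bVb); rewrite ba !mulrA mulTTV // -(mulrA _ a) aaV mulr1.
by rewrite (TTV rel).
Qed.

End Swaps.

Lemma swapsX k : (k < N)%N -> swaps k (X k) (X k.+1).
Proof. exact: (TXT rel). Qed.

Lemma swapsXV k : (k < N)%N -> swaps k (XV k.+1) (XV k).
Proof.
move=> kN; apply: (swapsV kN (swapsX kN)).
- by apply: (XXV rel); lia.
- by apply: (XVX rel); lia.
- by apply: (XVX rel); lia.
Qed.

Lemma swapsY k : (k < N)%N -> swaps k (Y k.+1) (Y k).
Proof. exact: (TYT rel). Qed.

Lemma swapsYV k : (k < N)%N -> swaps k (YV k) (YV k.+1).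
Proof.
move=> kN; apply: (swapsV kN (swapsY kN)).
- by apply: (YYV rel); lia.
- by apply: (YVY rel); lia.
- by apply: (YVY rel); lia.
Qed.

Lemma TXV k i : (k < N)%N -> (i <= N)%N -> i <> k -> i <> k.+1 ->
  T k * XV i = XV i * T k.
Proof.
move=> kN iN ik ik1; apply: commV (TX rel kN iN ik ik1).
  exact: (XXV rel).
exact: (XVX rel).
Qed.

Lemma TYV k i : (k < N)%N -> (i <= N)%N -> i <> k -> i <> k.+1 ->
  T k * YV i = YV i * T k.
Proof.
move=> kN iN ik ik1; apply: commV (TY rel kN iN ik ik1).
  exact: (YYV rel).
exact: (YVY rel).
Qed.

Lemma TV_comm k x : (k < N)%N -> T k * x = x * T k -> TV k * x = x * TV k.
Proof.
by move=> kN e; rewrite (TVE rel) // mulrBl mulrBr e (central_c rel).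
Qed.

Lemma Yprod_prefix_comm m i : (m <= N.+1)%N -> (i <= N)%N ->
  Y i * (\prod_(j < m) Y j) = (\prod_(j < m) Y j) * Y i.
Proof.
move=> + iN; elim: m => [|m IHm] mN; first by rewrite big_ord0 mulr1 mul1r.
by rewrite big_ord_recr /= mulrA (IHm (ltnW mN)) -!mulrA (YY rel iN mN).
Qed.

Lemma YprodY i : (i <= N)%N -> Y i * Yt = Yt * Y i.
Proof. exact: Yprod_prefix_comm. Qed.

Lemma YprodYV i : (i <= N)%N -> YV i * Yt = Yt * YV i.
Proof.
move=> iN; apply/esym/commV; [exact: (YYV rel)|exact: (YVY rel)|].
by rewrite YprodY.
Qed.

(** The pair with indices $k$, $k+1$ is handled by
    $T_kY_{k+1}Y_k=T_kY_{k+1}T_kY_{k+1}T_k=Y_kY_{k+1}T_k$; all other factors commute with [T k]. *)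
Lemma TYprod k : (k < N)%N -> T k * Yt = Yt * T k.
Proof.
move=> kN; rewrite /Yt.
have low m : (m <= k)%N ->
    T k * (\prod_(j < m) Y j) = (\prod_(j < m) Y j) * T k.
  elim: m => [|m IHm] mk; first by rewrite big_ord0 mulr1 mul1r.
  rewrite big_ord_recr /= mulrA (IHm (ltnW mk)) -!mulrA.
  rewrite (TY (i:=m) rel kN) //; lia.
(* Prefixes are extended from length [k.+2], the first to contain both [Y k] and [Y k.+1]. *)
suff high m : (k.+2 + m <= N.+1)%N ->
    T k * (\prod_(j < k.+2 + m) Y j) = (\prod_(j < k.+2 + m) Y j) * T k.
  by rewrite -(subnKC kN); apply: (high (N.+1 - k.+2)%N); lia.
elim: m => [|m IHm] mN; last first.
  rewrite addnS big_ord_recr /= mulrA IHm; last by lia.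
  rewrite -!mulrA (TY (i:=(k.+2 + m)%N) rel kN) //; lia.
rewrite addn0 2!big_ord_recr /= -mulrA mulrA low // -!mulrA; congr (_ * _).
have kN' : (k <= N)%N by lia.
rewrite (YY rel kN' (kN : k.+1 <= N)%N) -{1}(TYT rel kN) !mulrA (TYT rel kN).
by rewrite -!mulrA; congr (Y k * _).
Qed.

Lemma Yprod_inv : exists YtV, Yt * YtV = 1 /\ YtV * Yt = 1.
Proof.
rewrite /Yt; suff H m : (m <= N.+1)%N ->
    exists V, \prod_(j < m) Y j * V = 1 /\ V * \prod_(j < m) Y j = 1.
  exact: H.
elim: m => [|m IHm] mN; first by exists 1; rewrite big_ord0 mulr1.
have [V [pV Vp]] := IHm (ltnW mN).
exists (YV m * V); rewrite big_ord_recr /= -!mulrA [Y m * _]mulrA (YYV rel) //.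
by rewrite mul1r pV (mulrA V) Vp mul1r (YVY rel).
Qed.


(** * The ring [K], and the left and right spans of the [X i] under multiplication by [T k] *)

Variable K : set A.
Hypotheses (KR : subring_set K) (Kc : K c) (Kq : K q) (KqV : K qV).
Hypothesis KT : forall k, (k < N)%N -> K (T k).
Hypothesis KY : forall i, (i <= N)%N -> K (Y i).
Hypothesis KYV : forall i, (i <= N)%N -> K (YV i).

Lemma KTV k : (k < N)%N -> K (TV k).
Proof. by move=> kN; rewrite (TVE rel) //; apply: subringB KR _ _; auto. Qed.

(** Supplies the one $Y_m$ that the relations do not reach directly: it is [Yt] times the inverse of
    the product of the others. With [m] at an end of the range, $Y_m$ splits off [Yt] at once. *)
Lemma Yset_complete (S : set A) (m : nat) YtV : (m <= N)%N ->
  (m = 0%N \/ m = N) -> S 1 -> (forall x y, S x -> S y -> S (x * y)) ->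
  S Yt -> Yt * YtV = 1 -> YtV * Yt = 1 -> S YtV ->
  (forall i, (i <= N)%N -> i <> m -> S (Y i) /\ S (YV i)) ->
  forall i, (i <= N)%N -> S (Y i) /\ S (YV i).
Proof.
move=> mN m0N S1 SM SYt YtK YtVK SYtV Sm i iN.
have [->|/eqP im] := eqVneq i m; last exact: Sm.
(* The members of [S] with a two-sided inverse in [S]; they are closed under products, so the
   product of the other $Y_j$ is one of them. *)
pose S2 x := S x /\ exists y, [/\ S y, x * y = 1 & y * x = 1].
have S2M x y : S2 x -> S2 y -> S2 (x * y).
  move=> [Sx [x' [Sx' xx' x'x]]] [Sy [y' [Sy' yy' y'y]]].
  split; first exact: SM.
  exists (y' * x'); split; first exact: SM.
    by rewrite !mulrA -(mulrA x) yy' mulr1.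
  by rewrite !mulrA -(mulrA y') x'x mulr1.
have [P [S2P YP PY]] : exists P, [/\ S2 P, Yt = Y m * P & Yt = P * Y m].
  have S2Y j : (j <= N)%N -> j <> m -> S2 (Y j).
    move=> jN jm; have [SY SYV] := Sm j jN jm; split=> //.
    by exists (YV j); split=> //; [exact: (YYV rel)|exact: (YVY rel)].
  have S21 : S2 1 by split=> //; exists 1; rewrite mulr1.
  case: m0N => m0.
    have YP : Yt = Y m * \prod_(j < N) Y j.+1 by rewrite /Yt big_ord_recl m0.
    exists (\prod_(j < N) Y j.+1); split=> //; last first.
    - rewrite -[LHS]mul1r -(YVY rel mN) -mulrA (YprodY mN) YP !mulrA.
      by rewrite (YVY rel) // mul1r.
    - by elim/big_ind: _ => // j _; apply: S2Y; [have := ltn_ord j; lia|lia].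
  exists (\prod_(j < N) Y j); split; last 2 first.
  - have := Yprod_prefix_comm (leqnSn N) mN; rewrite m0 => ->.
    by rewrite /Yt big_ord_recr.
  - by rewrite /Yt big_ord_recr m0.
  - by elim/big_ind: _ => // j _; apply: S2Y; have := ltn_ord j; lia.
have [SP [PV [SPV PPV PVP]]] := S2P.
have eY : Y m = Yt * PV by rewrite YP -mulrA PPV mulr1.
have eYV : YV m = P * YtV.
  apply: (invU (YVY rel mN)); by rewrite mulrA -YP.
by rewrite eY eYV; split; apply: SM.
Qed.

Definition Xset : set A := [set x | exists2 i, (i <= N)%N & x = X i].
Definition Yset : set A :=
  [set x | exists2 i, (i <= N)%N & x = Y i \/ x = YV i].

Definition KX := mulspan K Xset.
Definition XK := mulspan Xset K.

Lemma KX_Kl a x : K a -> KX x -> KX (a * x).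
Proof. by move=> Ka; apply: mulspanMl => y; exact: (subringM KR). Qed.

Lemma XK_Kr a x : K a -> XK x -> XK (x * a).
Proof. by move=> Ka; apply: mulspanMr => y /(subringM KR); apply. Qed.

Lemma KX_X i : (i <= N)%N -> KX (X i).
Proof.
by move=> iN; rewrite -[X i]mul1r; apply: mulspanM; [case: KR|exists i].
Qed.

Lemma XK_X i : (i <= N)%N -> XK (X i).
Proof.
by move=> iN; rewrite -[X i]mulr1; apply: mulspanM; [exists i|case: KR].
Qed.

(** Coefficients are moved to the left by $X_kT_k=T_k^{-1}X_{k+1}$ and
    $X_{k+1}T_k=T_kX_k+cX_{k+1}$. *)
Lemma KX_Tr k x : (k < N)%N -> KX x -> KX (x * T k).
Proof.
move=> kN; elim=> [|{}x y _ + _|{}x _ Kx [i iN ->]].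
- by rewrite mul0r; exact: mulspan0.
- by rewrite mulrDl; exact: mulspanD.
rewrite -mulrA; apply: KX_Kl => //.
have [->|/eqP ik] := eqVneq i k.
  rewrite (swaps_aT kN (swapsX kN)); apply: KX_Kl; [exact: KTV|exact: KX_X].
have [->|/eqP ik1] := eqVneq i k.+1.
  rewrite (swaps_bT kN (swapsX kN)).
  by apply: mulspanD; apply: KX_Kl; auto; apply: KX_X; lia.
by rewrite -(TX rel) //; apply: KX_Kl; [exact: KT|exact: KX_X].
Qed.

Lemma XK_Tl k x : (k < N)%N -> XK x -> XK (T k * x).
Proof.
move=> kN; elim=> [|{}x y _ + _|_ {}x [i iN ->] Kx].
- by rewrite mulr0; exact: mulspan0.
- by rewrite mulrDr; exact: mulspanD.
rewrite mulrA; apply: XK_Kr => //.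
have [->|/eqP ik] := eqVneq i k.
  rewrite (swaps_Ta kN (swapsX kN)); apply: XK_Kr; [exact: KTV|exact: XK_X].
have [->|/eqP ik1] := eqVneq i k.+1.
  rewrite (swaps_Tb kN (swapsX kN)) (central_c rel).
  by apply: mulspanD; apply: XK_Kr; auto; apply: XK_X; lia.
by rewrite (TX rel) //; apply: XK_Kr; [exact: KT|exact: XK_X].
Qed.

Lemma KX_TVr k x : (k < N)%N -> KX x -> KX (x * TV k).
Proof.
move=> kN Kx; rewrite (TVE rel) // mulrBr -(central_c rel).
apply: mulspanD; first exact: KX_Tr.
rewrite -mulNr; apply: KX_Kl => //.
exact: (subringN KR).
Qed.

Lemma XK_TVl k x : (k < N)%N -> XK x -> XK (TV k * x).
Proof.
move=> kN Kx; rewrite (TVE rel) // mulrBl.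
apply: mulspanD; first exact: XK_Tl.
rewrite (central_c rel) -mulrN; apply: XK_Kr => //.
exact: (subringN KR).
Qed.

(** The swap runs in opposite directions for [Y] and [YV], hence the two alternatives; either one
    lets an induction on the index of [X] move [T k] past [y]. *)
Lemma Yset_T k y : (k < N)%N -> Yset y -> T k * y = y * T k \/
  exists2 y', Yset y' & swaps k y y' \/ swaps k y' y.
Proof.
move=> kN [i iN yE].
have [ik|/eqP ik] := eqVneq i k.
  right; case: yE => ->; rewrite ik.
    by exists (Y k.+1); [exists k.+1; auto|right; exact: swapsY].
  by exists (YV k.+1); [exists k.+1; auto|left; exact: swapsYV].
have [ik1|/eqP ik1] := eqVneq i k.+1.
  right; have kN' : (k <= N)%N by lia.
  case: yE => ->; rewrite ik1.
    by exists (Y k); [exists k; auto|left; exact: swapsY].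
  by exists (YV k); [exists k; auto|right; exact: swapsYV].
by left; case: yE => ->; [exact: (TY rel)|exact: TYV].
Qed.


(** * Exchanging the extreme elements [X 0] and [X N] with the [Y i] *)

(* As T_0^2 = 1 + c * T_0, the conjugate of T_0^2 by T_m ... T_1 is           *)
(* 1 + c * conjT0 m.                                                          *)
Fixpoint conjT0 m : A :=
  if m is m'.+1 then T m * conjT0 m' * TV m else T 0%N.
Fixpoint conjTV0 m : A :=
  if m is m'.+1 then T m * conjTV0 m' * TV m else TV 0%N.

Lemma conjT0E m : (m < N)%N -> conjT0 m = conjTV0 m + c.
Proof.
elim: m => [|m IHm] mN /=; first by rewrite (TVE rel) // subrK.
rewrite IHm ?(ltnW mN) // mulrDr mulrDl; congr (_ + _).
by rewrite -(central_c rel) -mulrA (TTV rel) // mulr1.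
Qed.

Lemma conjT0K m : (m < N)%N -> conjT0 m * conjTV0 m = 1.
Proof.
elim: m => [|m IHm] mN /=; first exact: (TTV rel).
rewrite !mulrA mulTVT // -(mulrA (T _)) IHm ?(ltnW mN) // mulr1.
exact: (TTV rel).
Qed.

Lemma K_conjT0 m : (m < N)%N -> K (conjT0 m).
Proof.
elim: m => [|m IHm] mN /=; first exact: KT.
apply: (subringM KR); last exact: KTV.
by apply: (subringM KR); [exact: KT|exact: IHm (ltnW mN)].
Qed.

Lemma K_conjTV0 m : (m < N)%N -> K (conjTV0 m).
Proof.
move=> mN; rewrite -[conjTV0 m](addrK c) -conjT0E //.
by apply: (subringB KR) => //; exact: K_conjT0.
Qed.

(** Induction from $X_0Y_1=Y_1T_0^2X_0$: in $Y_{m+2}=T_{m+1}^{-1}Y_{m+1}T_{m+1}^{-1}$ the outer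
    factors commute with $X_0$, so that the conjugate of $T_0^2$ is conjugated once more, by
    $T_{m+1}$. *)
Lemma X0Y m : (m < N)%N ->
  X 0%N * Y m.+1 = Y m.+1 * (1 + c * conjT0 m) * X 0%N.
Proof.
elim: m => [|m IHm] mN; first by rewrite (X0Y1 rel) /= -T_sqE // !mulrA.
have eY : Y m.+2 = TV m.+1 * Y m.+1 * TV m.+1.
  rewrite -(TYT rel mN) !mulrA (TVT rel) // mul1r mulTTV //.
have eX : TV m.+1 * X 0%N = X 0%N * TV m.+1.
  by apply: TV_comm => //; apply: (TX rel); lia.
rewrite {1}eY !mulrA -eX -(mulrA (TV _)) IHm ?(ltnW mN) // eY /= -!mulrA -eX.
rewrite !mulrA; congr (_ * _).
rewrite [in RHS]mulrDr !mulrDr !mulr1 !mulrDl -!mulrA; congr (_ + _).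
rewrite (mulrA c (T _)) [c * T _](central_c rel) !mulrA mulTVT //.
Qed.

(** With $t$ = [conjT0 m], the identity $t-t^{-1}=c$ makes $1-ct^{-1}$ the inverse of $1+ct$, and
    [X0Y] can be solved for $X_0Y_{m+1}^{-1}$. *)
Lemma X0YV m : (m < N)%N ->
  X 0%N * YV m.+1 = (1 - c * conjTV0 m) * YV m.+1 * X 0%N.
Proof.
move=> mN; set u := 1 + c * conjT0 m; set v := 1 - _.
have vu : v * u = 1.
  rewrite /v /u mulrDr mulr1 mulrBl mul1r -!mulrA (mulrA (conjTV0 m)).
  rewrite -(central_c rel (conjTV0 m)) -!mulrA.
  have -> : conjTV0 m * conjT0 m = 1.
    by rewrite -(conjT0K mN) conjT0E // mulrDl mulrDr (central_c rel).
  rewrite conjT0E // !mulr1 mulrDr.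
  by rewrite addrK subrK.
have e := X0Y mN; rewrite -/u in e.
rewrite -[X 0%N in RHS]mulr1 -(YYV rel mN) -!mulrA (mulrA (X 0%N)) e.
by rewrite !mulrA -(mulrA v) (YVY rel) // mulr1 vu mul1r.
Qed.


(** The conjugating $T_i$ with $i\ge1$ commute with $X_0$, and the chain carries $X_0$ to $X_{m+1}$
    one index at a time. This turns $X_0$ into $X_N$ in [X0D_comm]. *)
Lemma conjT0_X0 m : (m < N)%N ->
  exists2 w, K w & conjT0 m * X 0%N = X m.+1 * w.
Proof.
elim: m => [|m IHm] mN /=.
  exists (TV 0%N); first exact: KTV.
  exact: (swaps_Ta mN (swapsX mN)).
have [w Kw e] := IHm (ltnW mN).
exists (TV m.+1 * w * TV m.+1).
  by apply: (subringM KR); [apply: (subringM KR)|]; rewrite ?KTV //; apply: KTV.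
have eX : TV m.+1 * X 0%N = X 0%N * TV m.+1.
  by apply: TV_comm => //; apply: (TX rel); lia.
rewrite -(mulrA _ _ (X 0%N)) eX !mulrA -(mulrA (T _)) e.
by rewrite !mulrA (swaps_Ta mN (swapsX mN)).
Qed.

(** For [m = 0] the relation between $X_0$ and $Y_1$ gives $v=T_0^{-2}$; each further step
    conjugates [v] by the next $T_i$. The inverse [vV] serves to treat $Y_0^{-1}$ as well. *)
Lemma Y0X m : (m < N)%N -> exists v vV,
  [/\ K v, K vV, v * vV = 1, vV * v = 1 & Y 0%N * X m.+1 = X m.+1 * v * Y 0%N].
Proof.
elim: m => [|m IHm] mN.
  have KT0 := KT mN; have KTV0 := KTV mN.
  exists (TV 0%N * TV 0%N), (T 0%N * T 0%N); split.
  - exact: (subringM KR).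
  - exact: (subringM KR).
  - by rewrite !mulrA mulTVT // (TVT rel).
  - by rewrite !mulrA mulTTV // (TTV rel).
  rewrite -(TXT rel mN) -(TYT rel mN) !mulrA !mulTTV // mulTVT //.
  have := X0Y1 rel; set a := T 0%N; set b := X _; set d := Y _ => e.
  by rewrite -(mulrA a b d) e !mulrA.
have [v [vV [Kv KvV vvV vVv e]]] := IHm (ltnW mN).
have KT' := KT mN; have KTV' := KTV mN.
exists (TV m.+1 * v * T m.+1), (TV m.+1 * vV * T m.+1); split.
- by do ?apply: (subringM KR).
- by do ?apply: (subringM KR).
- by rewrite !mulrA mulTTV // -(mulrA _ v) vvV mulr1 (TVT rel).
- by rewrite !mulrA mulTTV // -(mulrA _ vV) vVv mulr1 (TVT rel).
have eY : T m.+1 * Y 0%N = Y 0%N * T m.+1 by apply: (TY rel); lia.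
rewrite -(TXT rel mN) !mulrA -eY mulTTV // -!mulrA eY !mulrA -(mulrA (T _)) e.
by rewrite !mulrA.
Qed.

Variable YtV : A.
Hypotheses (YtK : Yt * YtV = 1) (YtVK : YtV * Yt = 1).

Lemma KYt : K Yt.
Proof.
by rewrite /Yt; elim/big_ind: _ => [|x y|i _];
  [case: KR|exact: (subringM KR)|apply: KY; have := ltn_ord i; lia].
Qed.

Lemma KYtV : K YtV.
Proof.
suff [P [KP PYt]] : exists P, K P /\ P * Yt = 1 by rewrite -(invU PYt YtK).
rewrite /Yt; suff H m : (m <= N.+1)%N ->
    exists P, K P /\ P * \prod_(j < m) Y j = 1 by exact: H.
elim: m => [|m IHm] mN; first by exists 1; rewrite big_ord0 mulr1; case: KR.
have [P [KP Pp]] := IHm (ltnW mN).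
exists (YV m * P); split; first by apply: (subringM KR) => //; apply: KYV.
by rewrite big_ord_recr /= mulrA -(mulrA (YV m)) Pp mulr1 (YVY rel).
Qed.

Lemma YtVX i : (i <= N)%N -> YtV * X i = qV * X i * YtV.
Proof.
move=> iN; have e := YprodX rel iN; rewrite -/Yt in e.
have XYtV : X i * YtV = q * (YtV * X i).
  rewrite -[X i in LHS]mul1r -YtVK -(mulrA YtV) e -!mulrA YtK mulr1.
  by rewrite !mulrA (central_q rel).
by rewrite -mulrA XYtV mulrA (central_qV rel) (qqV rel) mul1r.
Qed.

(** [X0Y] and [X0YV] cover the positive indices; the $q$-commutation of $X_0$ with [Yt] then yields
    $Y_0$ through [Yset_complete]. *)
Lemma YsetX0 i : (i <= N)%N ->
  (exists2 h, K h & X 0%N * Y i = h * X 0%N) /\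
  (exists2 h, K h & X 0%N * YV i = h * X 0%N).
Proof.
pose S y := exists2 h, K h & X 0%N * y = h * X 0%N.
apply: (@Yset_complete S 0%N YtV) => //; first by left.
- by exists 1; rewrite ?mul1r ?mulr1 //; case: KR.
- move=> x y [h Kh e] [h' Kh' e']; exists (h * h'); first exact: (subringM KR).
  by rewrite mulrA e -mulrA e' mulrA.
- exists (qV * Yt); first by apply: (subringM KR) => //; exact: KYt.
  rewrite -mulrA (YprodX rel) // !mulrA (central_qV rel) (qqV rel) mul1r //.
- exists (q * YtV); first by apply: (subringM KR) => //; exact: KYtV.
  rewrite -mulrA YtVX // !mulrA (qqV rel) mul1r //.
move=> [|m] mN // _; split.
- exists (Y m.+1 * (1 + c * conjT0 m)); last exact: X0Y.
  apply: (subringM KR); first exact: KY.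
  apply: (subringD KR); first by case: KR.
  by apply: (subringM KR) => //; exact: K_conjT0.
- exists ((1 - c * conjTV0 m) * YV m.+1); last exact: X0YV.
  apply: (subringM KR); last exact: KYV.
  apply: (subringB KR); first by case: KR.
  by apply: (subringM KR) => //; exact: K_conjTV0.
Qed.

(** [Y0X] starts an induction over $Y_0,\dots,Y_{N-1}$, and [Yset_complete] adds $Y_N$. *)
Lemma YsetXN i : (i <= N)%N ->
  (exists2 h, K h & Y i * X N = X N * h) /\
  (exists2 h, K h & YV i * X N = X N * h).
Proof.
pose S y := exists2 h, K h & y * X N = X N * h.
have SM x y : S x -> S y -> S (x * y).
  move=> [h Kh e] [h' Kh' e']; exists (h * h'); first exact: (subringM KR).
  by rewrite -mulrA e' mulrA e mulrA.
apply: (@Yset_complete S N YtV) => //; first by right.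
- by exists 1; rewrite ?mul1r ?mulr1 //; case: KR.
- exists (q * Yt); first by apply: (subringM KR) => //; exact: KYt.
  by rewrite (YprodX rel) // !mulrA (central_q rel).
- exists (qV * YtV); first by apply: (subringM KR) => //; exact: KYtV.
  by rewrite YtVX // !mulrA (central_qV rel).
move=> i' iN i'N; have {iN i'N}: (i' < N)%N by lia.
elim: i' => [|m IHm] mN.
  have [v [vV [Kv KvV vvV vVv e]]] := Y0X (ltnSn M).
  split.
    exists (v * Y 0%N); last by rewrite e mulrA.
    by apply: (subringM KR) => //; exact: KY.
  exists (YV 0%N * vV); first by apply: (subringM KR) => //; exact: KYV.
  rewrite -[X N in LHS]mulr1 -vvV (mulrA (X N)) mulrA.
  rewrite -[X N * v]mulr1 -(YYV rel (leq0n N)) (mulrA (X N * v)) -e.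
  by rewrite !mulrA (YVY rel) // mul1r.
(* As [m.+1 < N], [T m] commutes with [X N], so $Y_{m+1}=T_m^{-1}Y_mT_m^{-1}$ inherits the property
   from $Y_m$. *)
have mN1 : (m < N)%N by lia.
have [SY SYV] := IHm mN1.
have ST : S (T m).
  by exists (T m); [exact: KT|apply: (TX rel); lia].
have STV : S (TV m).
  exists (TV m); first exact: KTV.
  by apply: TV_comm => //; apply: (TX rel); lia.
split.
  have -> : Y m.+1 = TV m * Y m * TV m.
    by rewrite -(TYT rel mN1) !mulrA (TVT rel) // mul1r mulTTV.
  by apply: (SM) => //; apply: SM.
rewrite -(swapsYV mN1).
by apply: (SM) => //; apply: SM.
Qed.


(** * Two-sided stability of [KX] and [XK] under [K] *)

Lemma Yset_X0 y : Yset y -> exists2 h, K h & X 0%N * y = h * X 0%N.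
Proof. by case=> i iN [] ->; have [] := YsetX0 iN. Qed.

Lemma Yset_XN y : Yset y -> exists2 h, K h & y * X N = X N * h.
Proof. by case=> i iN [] ->; have [] := YsetXN iN. Qed.

(** Induction on the index from $X_0$, through $X_{i+1}=T_iX_iT_i$: [Yset_T] rewrites $T_iy$ with an
    element of [Yset] or [K] next to $X_i$. *)
Lemma KX_Yr x y : Yset y -> KX x -> KX (x * y).
Proof.
have XY i : (i <= N)%N -> forall y, Yset y -> KX (X i * y).
  elim: i => [|i IHi] iN {}y Yy.
    by have [h Kh ->] := Yset_X0 Yy; apply: KX_Kl => //; exact: KX_X.
  rewrite -(TXT rel iN) -!mulrA; apply: KX_Kl; first exact: KT.
  have {}IHi z : Yset z -> KX (X i * z) by apply: IHi; exact: ltnW.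
  have [->|[z Yz [yz|zy]]] := Yset_T iN Yy.
  - by rewrite mulrA; apply: KX_Tr => //; exact: IHi.
  - by rewrite (swaps_Ta iN yz) mulrA; apply: KX_TVr => //; exact: IHi.
  - rewrite (swaps_Tb iN zy) mulrDr mulrA; apply: mulspanD.
      by apply: KX_Tr => //; exact: IHi.
    by rewrite mulrA -(central_c rel) -mulrA; apply: KX_Kl => //; exact: IHi.
move=> Yy; elim=> [|{}x z _ + _|{}x _ Kx [i iN ->]].
- by rewrite mul0r; exact: mulspan0.
- by rewrite mulrDl; exact: mulspanD.
- by rewrite -mulrA; apply: KX_Kl => //; exact: XY.
Qed.

(** The induction descends from $X_N$, where [Yset_XN] applies, through
    $X_k=T_k^{-1}X_{k+1}T_k^{-1}$. *)
Lemma XK_Yl x y : Yset y -> XK x -> XK (y * x).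
Proof.
have XY i : (i <= N)%N -> forall y, Yset y -> XK (y * X i).
  move=> iN; rewrite -(subKn iN); elim: (N - i)%N => [|d IHd] {}y Yy.
    rewrite subn0; have [h Kh ->] := Yset_XN Yy.
    by apply: XK_Kr => //; exact: XK_X.
  (* For [d >= N] truncated subtraction gives the index of the previous step again. *)
  have [dN|Nd] := ltnP d N; last first.
    have -> : (N - d.+1 = N - d)%N by lia.
    exact: IHd.
  move: IHd; have -> : (N - d = (N - d.+1).+1)%N by lia.
  set k := (N - d.+1)%N => IHd; have kN : (k < N)%N by rewrite /k; lia.
  have -> : X k = TV k * X k.+1 * TV k.
    by rewrite -(TXT rel kN) !mulrA (TVT rel) // mul1r mulTTV.
  rewrite mulrA; apply: XK_Kr; first exact: KTV.
  have yT : y * TV k = y * T k - c * y.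
    by rewrite (TVE rel) // mulrBr (central_c rel).
  rewrite mulrA yT mulrBl; apply: mulspanD; last first.
    rewrite -mulrA (central_c rel) -mulrN; apply: XK_Kr; last exact: IHd.
    exact: (subringN KR).
  have [<-|[z Yz [yz|zy]]] := Yset_T kN Yy.
  - by rewrite -mulrA; apply: XK_Tl => //; exact: IHd.
  - by rewrite (swaps_aT kN yz) -mulrA; apply: XK_TVl => //; exact: IHd.
  - rewrite (swaps_bT kN zy) mulrDl -mulrA; apply: mulspanD.
      by apply: XK_Tl => //; exact: IHd.
    by rewrite -mulrA (central_c rel); apply: XK_Kr => //; exact: IHd.
move=> Yy; elim=> [|{}x z _ + _|_ {}x [i iN ->] Kx].
- by rewrite mulr0; exact: mulspan0.
- by rewrite mulrDr; exact: mulspanD.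
- by rewrite mulrA; apply: XK_Kr => //; exact: XY.
Qed.

(* Z stands for the scalars, so that K_ind says that K is the subalgebra      *)
(* generated by the T k, Y i and YV i.                                        *)
Variable Z : set A.
Hypotheses (ZC : forall z x, Z z -> z * x = x * z) (ZK : forall z, Z z -> K z).
Hypothesis K_ind : forall P : set A, subring_set P -> (forall z, Z z -> P z) ->
  (forall k, (k < N)%N -> P (T k)) -> (forall y, Yset y -> P y) ->
  forall h, K h -> P h.

(** The right multipliers preserving [KX] form a subring, so [K_ind] reduces the claim to
    generators. *)
Lemma KX_Kr h x : K h -> KX x -> KX (x * h).
Proof.
move=> Kh; move: h Kh x.
apply: (K_ind (P := [set h | forall x, KX x -> KX (x * h)])) 
  => [|z Zz x|k kN x|y Yy x].
- split=> [x|h h' Sh Sh' x Xx|h Sh x Xx|h h' Sh Sh' x Xx].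
  + by rewrite mulr1.
  + by rewrite mulrDr; apply: mulspanD; [exact: Sh|exact: Sh'].
  + rewrite mulrN -mulN1r; apply: KX_Kl; last exact: Sh.
    by apply: (subringN KR); case: KR.
  + by rewrite mulrA; apply: Sh'; exact: Sh.
- by rewrite -ZC //; apply: KX_Kl; exact: ZK.
- exact: KX_Tr.
- exact: KX_Yr.
Qed.

Lemma XK_Kl h x : K h -> XK x -> XK (h * x).
Proof.
move=> Kh; move: h Kh x.
apply: (K_ind (P := [set h | forall x, XK x -> XK (h * x)])) 
  => [|z Zz x|k kN x|y Yy x].
- split=> [x|h h' Sh Sh' x Xx|h Sh x Xx|h h' Sh Sh' x Xx].
  + by rewrite mul1r.
  + by rewrite mulrDl; apply: mulspanD; [exact: Sh|exact: Sh'].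
  + rewrite mulNr -mulrN1; apply: XK_Kr; last exact: Sh.
    by apply: (subringN KR); case: KR.
  + by rewrite -mulrA; apply: Sh; exact: Sh'.
- by rewrite ZC //; apply: XK_Kr; exact: ZK.
- exact: XK_Tl.
- exact: XK_Yl.
Qed.

Lemma KX_sub_XK x : KX x -> XK x.
Proof.
elim=> [|{}x y _ + _|h _ Kh [i iN ->]]; [exact: mulspan0|exact: mulspanD|].
by apply: XK_Kl => //; exact: XK_X.
Qed.

(** * The element [D] and its products with [X 0] and [X N] *)

Variable s : A.
Hypotheses (sC : forall x, s * x = x * s) (Ks : K s).
(** This is $D_n$, with an arbitrary central [s] in [K] in place of $(q-q^{-1})^{-1}$. *)
Let D := s * (XV N * (Y N - YV N)).

Lemma TD k : (k < M)%N -> T k * D = D * T k.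
Proof.
move=> kM; rewrite /D mulrA -sC -!mulrA; congr (s * _).
have kN : (k < N)%N by lia.
rewrite mulrA (TXV kN) //; [|lia..].
rewrite -!mulrA; congr (_ * _); rewrite mulrBl mulrBr (TY rel kN) //; [|lia..].
by rewrite (TYV kN) //; lia.
Qed.

Lemma XND : K (X N * D).
Proof.
rewrite mulrA -sC mulrA -(mulrA s) (XXV rel) // mulr1.
apply: (subringM KR) => //.
by apply: (subringB KR); [exact: KY|exact: KYV].
Qed.

Lemma conj_XN y : Yset y -> K (XV N * y * X N).
Proof.
by move=> /Yset_XN[h Kh e]; rewrite -mulrA e mulrA (XVX rel) // mul1r.
Qed.

Lemma DXN : K (D * X N).
Proof.
rewrite -!mulrA; apply: (subringM KR) => //.
rewrite mulrA mulrBr mulrBl; apply: (subringB KR); apply: conj_XN.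
  by exists N; auto.
by exists N; auto.
Qed.

(** Induction strips the conjugating $T_i$; the base case is
    $X_1^{-1}T_0^{-1}Y_1^{-1}X_0=X_1^{-1}Y_0^{-1}X_1T_0^{-1}$, which [Y0X] puts in [K]. *)
Lemma XV_conjTV0_YV_X0 m : (m < N)%N ->
  K (XV m.+1 * conjTV0 m * YV m.+1 * X 0%N).
Proof.
elim: m => [|m IHm] mN.
  have KTV0 := KTV mN.
  rewrite /= -(swapsYV mN) !mulrA mulTVT // -(mulrA _ (T 0%N)).
  rewrite (swaps_Ta mN (swapsX mN)) mulrA; apply: (subringM KR) => //.
  have [v [vV [Kv KvV vvV vVv e]]] := Y0X mN.
  suff -> : XV 1%N * YV 0%N * X 1%N = YV 0%N * vV.
    by apply: (subringM KR) => //; exact: KYV.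
  apply/esym; rewrite -[LHS]mul1r -(XVX rel mN) -!mulrA; congr (_ * _).
  rewrite -[X 1%N in LHS]mul1r -(YVY rel (leq0n N)) -(mulrA (YV _)) e.
  rewrite -!mulrA (mulrA (Y 0%N)) (YYV rel) // mul1r vvV mulr1 //.
have KTV' := KTV mN.
have eX : T m.+1 * X 0%N = X 0%N * T m.+1 by apply: (TX rel); lia.
have eXV : XV m.+2 = TV m.+1 * XV m.+1 * TV m.+1.
  by rewrite -(swapsXV mN) !mulrA (TVT rel) // mul1r mulTTV.
rewrite /= -(swapsYV mN) eXV !mulrA !mulTVT // -(mulrA _ (T _)) eX mulrA.
apply: (subringM KR); last exact: KT.
rewrite -!mulrA; apply: (subringM KR) => //; rewrite !mulrA.
exact: IHm (ltnW mN).
Qed.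

(** $X_0$ commutes with $X_N^{-1}$, so only $[X_0,Y_N-Y_N^{-1}]$ matters. The leading terms of [X0Y]
    and [X0YV] cancel in it and leave $c(Y_NtX_0+t^{-1}Y_N^{-1}X_0)$ with $t$ = [conjT0 M]; after
    multiplication by $X_N^{-1}$ both terms lie in [K]. *)
Lemma X0D_comm : K (X 0%N * D - D * X 0%N).
Proof.
have eX : X 0%N * XV N = XV N * X 0%N.
  by apply: commV; [exact: (XXV rel)|exact: (XVX rel)|apply: (XX rel)].
have -> : X 0%N * D - D * X 0%N = s * (c * (XV N * Y N * conjT0 M * X 0%N +
    XV N * conjTV0 M * YV N * X 0%N)).
  have e1 : Y N * (1 + c * conjT0 M) * X 0%N =
      Y N * X 0%N + c * (Y N * conjT0 M * X 0%N).
    by rewrite mulrDr mulr1 mulrDl (mulrA (Y N)) -(central_c rel) !mulrA.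
  have e2 : (1 - c * conjTV0 M) * YV N * X 0%N =
      YV N * X 0%N - c * (conjTV0 M * YV N * X 0%N).
    by rewrite !mulrBl mul1r !mulrA.
  rewrite /D mulrA -sC -!mulrA -mulrBr; congr (s * _).
  rewrite (mulrA (X 0%N)) eX -!mulrA -mulrDr (mulrA c) (central_c rel) -mulrA.
  rewrite -mulrBr [X 0%N * (_ - _)]mulrBr (X0Y (ltnSn M)) (X0YV (ltnSn M)).
  rewrite e1 e2 opprB.
  rewrite [c * _ - _]addrC addrACA -mulrBl addrAC subrr add0r.
  by rewrite -mulrDr !mulrA.
apply: (subringM KR) => //; apply: (subringM KR) => //; apply: (subringD KR).
  (* $tX_0=X_Nw$ turns the first summand into $X_N^{-1}Y_NX_N$ times $w$. *)
  have [w Kw e] := conjT0_X0 (ltnSn M).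
  rewrite -mulrA e mulrA; apply: (subringM KR) => //.
  by apply: conj_XN; exists N; auto.
exact: XV_conjTV0_YV_X0.
Qed.


(** * Products of the [K]-bimodules of the [X i] and of [D] *)

Definition KDK := mulspan (mulspan K [set D]) K.

Lemma KDK_D : KDK D.
Proof.
have K1 := subring1 KR.
by rewrite -[D]mulr1 -[D]mul1r; apply: mulspanM => //; apply: mulspanM.
Qed.

Lemma KDK_Kl h x : K h -> KDK x -> KDK (h * x).
Proof.
move=> Kh; apply: mulspanMl => y; apply: mulspanMl => z; exact: (subringM KR).
Qed.

Lemma KDK_Kr h x : K h -> KDK x -> KDK (x * h).
Proof. by move=> Kh; apply: mulspanMr => y /(subringM KR); apply. Qed.

(** Everything reduces to $X_0D$: for $i<M$, $X_{i+1}D=T_iX_iDT_i$ because $T_i$ commutes with $D$,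
    and $X_ND$ is in [K]. In use, [S] is either $K+WV$ or [Hgl]. *)
Lemma KX_KDK_closed (S : set A) :
  (forall x y, S x -> S y -> S (x + y)) ->
  (forall h x, K h -> S x -> S (h * x)) ->
  (forall h x, K h -> S x -> S (x * h)) ->
  (forall x, K x -> S x) -> S (X 0%N * D) ->
  forall x y, KX x -> KDK y -> S (x * y).
Proof.
move=> SD Sl Sr SK S0 x y Xx; have S00 : S 0 by apply/SK/(subring0 KR).
have XD i : (i <= N)%N -> S (X i * D).
  elim: i => [//|i IHi] iN; have [iM|Mi] := ltnP i M.
    rewrite -(TXT rel iN) -(mulrA _ (T i)) TD // (mulrA _ D) -(mulrA _ (X i)).
    by apply: Sr; [exact: KT|apply: Sl; [exact: KT|apply: IHi; lia]].
  have -> : i.+1 = N by lia.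
  exact/SK/XND.
elim=> [|{}y y' _ + _|{}y k Dy Kk]; first by rewrite mulr0.
  by rewrite mulrDr; exact: SD.
rewrite mulrA; apply: Sr => //.
elim: y / Dy => [|y y' _ + _|k' _ Kk' ->]; first by rewrite mulr0.
  by rewrite mulrDr; exact: SD.
rewrite mulrA; have := KX_Kr Kk' Xx.
elim=> [|z z' _ + _|h _ Kh [i iN ->]]; first by rewrite mul0r.
  by rewrite mulrDl; exact: SD.
by rewrite -mulrA; apply: Sl => //; exact: XD.
Qed.

Lemma KDK_KX_closed (S : set A) :
  (forall x y, S x -> S y -> S (x + y)) ->
  (forall h x, K h -> S x -> S (h * x)) ->
  (forall h x, K h -> S x -> S (x * h)) ->
  (forall x, K x -> S x) -> S (D * X 0%N) ->
  forall x y, KX x -> KDK y -> S (y * x).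
Proof.
move=> SD Sl Sr SK S0 x y Xx; have S00 : S 0 by apply/SK/(subring0 KR).
have XD i : (i <= N)%N -> S (D * X i).
  elim: i => [//|i IHi] iN; have [iM|Mi] := ltnP i M.
    rewrite -(TXT rel iN) (mulrA D) (mulrA D) -TD // -(mulrA _ D).
    by apply: Sr; [exact: KT|apply: Sl; [exact: KT|apply: IHi; lia]].
  have -> : i.+1 = N by lia.
  exact/SK/DXN.
elim=> [|{}y y' _ + _|{}y k Dy Kk]; first by rewrite mul0r.
  by rewrite mulrDl; exact: SD.
(* The element of [K] between $D$ and the $X_i$ is absorbed by passing to the form $\sum_iX_iK$. *)
rewrite -mulrA; have := XK_Kl Kk (KX_sub_XK Xx); move: (k * x) => {Xx}x.
elim: y / Dy => [|y y' _ IHy _ IHy'|k' _ Kk' ->] Xx; first by rewrite mul0r.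
  by rewrite mulrDl; apply: SD; auto.
rewrite -mulrA; apply: Sl => //.
elim: x / Xx => [|z z' _ + _|_ h [i iN ->] Kh]; first by rewrite mulr0.
  by rewrite mulrDr; exact: SD.
by rewrite mulrA; apply: Sr => //; exact: XD.
Qed.

Section Addset.
Variable S : set A.
Hypotheses (S0 : S 0) (SD : forall x y, S x -> S y -> S (x + y)).
Hypotheses (Sl : forall h x, K h -> S x -> S (h * x))
  (Sr : forall h x, K h -> S x -> S (x * h)).

Lemma addsetD x y : addset K S x -> addset K S y -> addset K S (x + y).
Proof.
move=> [k Kk Sx] [k' Kk' Sy]; exists (k + k'); first exact: (subringD KR).
by rewrite opprD addrACA; exact: SD.
Qed.

Lemma addsetMl h x : K h -> addset K S x -> addset K S (h * x).
Proof.
move=> Kh [k Kk Sx]; exists (h * k); first exact: (subringM KR).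
by rewrite -mulrBr; exact: Sl.
Qed.

Lemma addsetMr h x : K h -> addset K S x -> addset K S (x * h).
Proof.
move=> Kh [k Kk Sx]; exists (k * h); first exact: (subringM KR).
by rewrite -mulrBl; exact: Sr.
Qed.

Lemma addset_K x : K x -> addset K S x.
Proof. by move=> Kx; exists x; rewrite ?subrr. Qed.

End Addset.

Lemma KX_KDK x y : KX x -> KDK y -> addset K (mulspan KDK KX) (x * y).
Proof.
apply: KX_KDK_closed.
- by apply: addsetD; exact: mulspanD.
- by apply: addsetMl => h z Kh; apply: mulspanMl => ?; exact: KDK_Kl.
- by apply: addsetMr => h z Kh; apply: mulspanMr => ?; exact: KX_Kr.
- by apply: addset_K; exact: mulspan0.
(* The commutator is the [K] part; what remains is $DX_0$. *)
- exists (X 0%N * D - D * X 0%N); first exact: X0D_comm.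
  by rewrite subKr; apply: mulspanM; [exact: KDK_D|exact: KX_X].
Qed.

Lemma KDK_KX x y : KX x -> KDK y -> addset K (mulspan KX KDK) (y * x).
Proof.
apply: KDK_KX_closed.
- by apply: addsetD; exact: mulspanD.
- by apply: addsetMl => h z Kh; apply: mulspanMl => ?; exact: KX_Kl.
- by apply: addsetMr => h z Kh; apply: mulspanMr => ?; exact: KDK_Kr.
- by apply: addset_K; exact: mulspan0.
- exists (D * X 0%N - X 0%N * D).
    by rewrite -opprB; apply: (subringN KR); exact: X0D_comm.
  by rewrite subKr; apply: mulspanM; [exact: KX_X|exact: KDK_D].
Qed.

End Relations.

(** * Degrees in an abstract setting: [V] raises, [W] lowers, [H] preserves *)

Section Grading.
Variables (A : pzRingType) (K H V W : set A).
Hypotheses (HR : subring_set H) (KH : forall x, K x -> H x).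
Hypotheses (V_Kl : forall k x, K k -> V x -> V (k * x))
  (W_Kl : forall k x, K k -> W x -> W (k * x)).
Hypothesis VW : forall v w, V v -> W w -> addset K (mulspan W V) (v * w).
Hypothesis WV : forall v w, V v -> W w -> addset K (mulspan V W) (w * v).
Hypothesis VWH : forall v w, V v -> W w -> H (v * w).
Hypothesis H_ind : forall P : set A, subring_set P -> (forall x, K x -> P x) ->
  (forall v w, V v -> W w -> P (v * w)) -> forall h, H h -> P h.

Lemma WVH v w : V v -> W w -> H (w * v).
Proof.
move=> Vv Ww; have [k Kk Hwv] := WV Vv Ww.
rewrite -[w * v](subrK k); apply: (subringD HR); last exact: KH.
apply: mulspan_sub Hwv; [exact: subring0 HR|exact: (subringD HR)|exact: VWH].
Qed.

(** The left multipliers of [mulspan S H] form a subring, so by [H_ind] only [K] and the products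
    $vw$ have to be checked. *)
Lemma mulspan_H_stable S :
  (forall k x, K k -> S x -> S (k * x)) ->
  (forall v w x, V v -> W w -> S x -> mulspan S H (v * w * x)) ->
  forall h x, H h -> mulspan S H x -> mulspan S H (h * x).
Proof.
move=> S_Kl SVW h x Hh; move: h Hh x.
apply: (H_ind (P := [set h | forall x, mulspan S H x -> mulspan S H (h * x)])).
- split=> [x|h h' Sh Sh' x Sx|h Sh x Sx|h h' Sh Sh' x Sx].
  + by rewrite mul1r.
  + by rewrite mulrDl; apply: mulspanD; [exact: Sh|exact: Sh'].
  + rewrite mulNr -mulrN1; apply: mulspanMr; last exact: Sh.
    by move=> z Hz; rewrite mulrN1; exact: (subringN HR).
  + by rewrite -mulrA; apply: Sh; exact: Sh'.
- by move=> k Kk x; apply: mulspanMl => z; exact: S_Kl.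
move=> v w Vv Ww x; elim=> [|{}x y _ + _|{}x h Sx Hh].
- by rewrite mulr0 => *; exact: mulspan0.
- by rewrite mulrDr; exact: mulspanD.
- rewrite mulrA; apply: mulspanMr; last exact: SVW.
  by move=> z Hz; exact: (subringM HR).
Qed.

(** $(vw)x=v(wx)$, where $wx$ is in [H] for $x$ in [V]. *)
Lemma HVH h x : H h -> mulspan V H x -> mulspan V H (h * x).
Proof.
apply: mulspan_H_stable => // v w x' Vv Ww Vx'.
by rewrite -mulrA; apply: mulspanM => //; exact: WVH.
Qed.

(** Here $vw$ stands in the wrong order: [VW] rewrites it as an element of [K] plus terms $w'v'$,
    and each $w'(v'x)$ lies in $WH$. *)
Lemma HWH h x : H h -> mulspan W H x -> mulspan W H (h * x).
Proof.
apply: mulspan_H_stable => // v w x' Vv Ww Wx'.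
have [k Kk vw] := VW Vv Ww; rewrite -[v * w](subrK k) mulrDl.
apply: mulspanD; last first.
  by rewrite -[_ * _]mulr1; apply: mulspanM; [exact: W_Kl|exact: (subring1 HR)].
elim: vw => [|y z _ + _|y z Wy Vz].
- by rewrite mul0r; exact: mulspan0.
- by rewrite mulrDl; exact: mulspanD.
- by rewrite -mulrA; apply: mulspanM => //; exact: VWH.
Qed.

Fixpoint powH (S : set A) d : set A :=
  if d is d'.+1 then mulspan S (powH S d') else H.

Lemma powH_Hl S : (forall h x, H h -> mulspan S H x -> mulspan S H (h * x)) ->
  forall d h x, H h -> powH S d x -> powH S d (h * x).
Proof.
move=> HSH; elim=> [h x|d IHd h x Hh] /=; first exact: (subringM HR).
elim=> [|{}x y _ + _|{}x y Sx dy].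
- by rewrite mulr0; exact: mulspan0.
- by rewrite mulrDr; exact: mulspanD.
(* [h] is carried past one element of [S]; what emerges on the right is in [H] and is absorbed by
   the induction hypothesis. *)
have : mulspan S H (h * x).
  apply: HSH => //; rewrite -[x]mulr1; apply: mulspanM => //.
  exact: (subring1 HR).
rewrite mulrA; elim: (h * x) / => [|z z' _ + _|z h' Sz Hh'].
- by rewrite mul0r; exact: mulspan0.
- by rewrite mulrDl; exact: mulspanD.
- by rewrite -mulrA; apply: mulspanM => //; exact: IHd.
Qed.

(** Degree 0 is the case [d = 0] of either family, namely [H]. The summands are told apart later, by
    their eigenvalues. *)
Inductive graded : set A :=
  | graded0 : graded 0
  | gradedD x y : graded x -> graded y -> graded (x + y)
  | gradedV d x : powH V d x -> graded x
  | gradedW d x : powH W d x -> graded x.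

Lemma graded_Hl h x : H h -> graded x -> graded (h * x).
Proof.
move=> Hh; elim=> [|{}x y _ + _|d {}x|d {}x].
- by rewrite mulr0; exact: graded0.
- by rewrite mulrDr; exact: gradedD.
- by move=> dx; apply: (@gradedV d); exact: powH_Hl HVH _ _ _ _ _.
- by move=> dx; apply: (@gradedW d); exact: powH_Hl HWH _ _ _ _ _.
Qed.

(** On $W^{d+1}H$ the product $vw$ falls into [H], which acts on the remaining $W^dH$. *)
Lemma graded_Vl v x : V v -> graded x -> graded (v * x).
Proof.
move=> Vv; elim=> [|{}x y _ + _|d {}x dx|[|d] {}x /= dx].
- by rewrite mulr0; exact: graded0.
- by rewrite mulrDr; exact: gradedD.
- by apply: (@gradedV d.+1); exact: mulspanM.
- by apply: (@gradedV 1); exact: mulspanM.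
elim: dx => [|{}x y _ + _|w y Ww dy].
- by rewrite mulr0; exact: graded0.
- by rewrite mulrDr; exact: gradedD.
- rewrite mulrA; apply: graded_Hl; [exact: VWH|exact: (@gradedW d)].
Qed.

Lemma graded_Wl w x : W w -> graded x -> graded (w * x).
Proof.
move=> Ww; elim=> [|{}x y _ + _|[|d] {}x /= dx|d {}x /= dx].
- by rewrite mulr0; exact: graded0.
- by rewrite mulrDr; exact: gradedD.
- by apply: (@gradedW 1); exact: mulspanM.
- elim: dx => [|{}x y _ + _|v y Vv dy].
  + by rewrite mulr0; exact: graded0.
  + by rewrite mulrDr; exact: gradedD.
  + rewrite mulrA; apply: graded_Hl; [exact: WVH|exact: (@gradedV d)].
- by apply: (@gradedW d.+1); exact: mulspanM.
Qed.

End Grading.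

(** * Weights under conjugation by [u] *)

Section Weights.
Variables (F : fieldType) (G : Type) (r : ncexpr F G -> ncexpr F G -> Prop).
Local Notation A := (palg r).
Variables (u uV : A).
Hypothesis uK : u * uV = 1.
Implicit Types (a b : F) (x y z : A).

(** For invertible [u] this is the eigenvector condition $uxu^{-1}=ax$, written without the
    inverse. *)
Definition weight a x := u * x = a *: (x * u).

Lemma weightM a b x y : weight a x -> weight b y -> weight (a * b) (x * y).
Proof.
rewrite /weight => ux uy; rewrite mulrA ux -scale_palgAl -mulrA uy.
by rewrite -scale_palgAr scalerA mulrA.
Qed.

Lemma weightD a x y : weight a x -> weight a y -> weight a (x + y).
Proof. by rewrite /weight => ux uy; rewrite mulrDr ux uy mulrDl scalerDr. Qed.

Lemma weight0 a : weight a 0.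
Proof. by rewrite /weight mulr0 mul0r scaler0. Qed.

Lemma weightV a x x' : a != 0 -> x * x' = 1 -> x' * x = 1 ->
  weight a x -> weight a^-1 x'.
Proof.
rewrite /weight => a0 xx' x'x ux.
have xu : x * u = a^-1 *: (u * x) by rewrite ux scalerA mulVf // scale1r.
rewrite -[LHS]mul1r -x'x -mulrA (mulrA x) xu -scale_palgAl -mulrA xx' mulr1.
by rewrite -scale_palgAr.
Qed.

Lemma weight1_subalg : is_subalg (weight 1).
Proof.
split=> [|a x y|x y wx wy].
- by rewrite /weight mulr1 mul1r scale1r.
- rewrite /weight !scale1r => wx wy.
  by rewrite mulrDr mulrDl -scale_palgAr wx wy scale_palgAl.
- by rewrite -[1]mulr1; exact: weightM.
Qed.

(* Multiplying by u x - a_1 x u kills the first summand and preserves the     *)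
(* weights of the others.                                                     *)
Lemma weight1_sum_eq0 (s : seq (F * A)) z :
  weight 1 z -> z = \sum_(p <- s) p.2 ->
  (forall p, p \in s -> p.1 != 1 /\ weight p.1 p.2) -> z = 0.
Proof.
have [n] := ubnP (size s); elim: n s z => // n IHn [|[a x] s] z /= sz wz.
  by rewrite big_nil.
rewrite big_cons /= => ze ws.
have [/= a1 wx] := ws _ (mem_head _ _).
have ws' p : p \in s -> p.1 != 1 /\ weight p.1 p.2.
  by move=> ps; apply: ws; rewrite inE ps orbT.
suff zu : (1 - a) *: (z * u) = 0.
  have /eqP := zu; rewrite scaler_eq0 subr_eq0 eq_sym (negPf a1) => /eqP zu0.
  by rewrite -[z]mulr1 -uK mulrA zu0 mul0r.
apply: (IHn [seq (p.1, (p.1 - a) *: (p.2 * u)) | p <- s]).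
- by rewrite size_map.
- by rewrite /weight scale1r -scale_palgAr -scale_palgAl mulrA wz scale1r.
- rewrite big_map /=.
  have -> : (1 - a) *: (z * u) = u * z - a *: (z * u).
    by rewrite wz scale1r scalerBl scale1r.
  rewrite ze mulrDr mulrDl scalerDr wx opprD addrACA subrr add0r.
  rewrite mulr_sumr mulr_suml scaler_sumr -sumrB big_seq [RHS]big_seq.
  by apply: eq_bigr => p /ws'[_ ->]; rewrite scalerBl.
- move=> _ /mapP[p ps ->] /=; have [p1 wp] := ws' _ ps; split=> //.
  by rewrite /weight -scale_palgAr mulrA wp -!scale_palgAl !scalerA mulrC.
Qed.

Variables (H V W : set A) (a : F).
Hypotheses (HR : subring_set H) (wH : forall x, H x -> weight 1 x).
Hypotheses (wV : forall x, V x -> weight a x)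
  (wW : forall x, W x -> weight a^-1 x).
Hypothesis aX : forall d, (0 < d)%N -> a ^+ d != 1.

Lemma weight_powH S b : (forall x, S x -> weight b x) ->
  forall d x, powH H S d x -> weight (b ^+ d) x.
Proof.
move=> wS; elim=> [|d IHd] x /=; first exact: wH.
elim=> [|{}x y _ + _|{}x y Sx /IHd]; [exact: weight0|exact: weightD|].
by rewrite exprS; apply: weightM; exact: wS.
Qed.

(** A graded element is some $h$ in [H] plus eigenvectors with eigenvalues $a^{\pm d}$, $d>0$, all
    different from 1. If it has weight 1, so has its difference with $h$, which then vanishes by
    [weight1_sum_eq0]. *)
Lemma weight1_graded x : graded H V W x -> weight 1 x -> H x.
Proof.
move=> gx wx; suff [h [s [Hh xE ws]]] : exists h (s : seq (F * A)),
    [/\ H h, x = h + \sum_(p <- s) p.2 &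
        forall p, p \in s -> p.1 != 1 /\ weight p.1 p.2].
  suff /eqP : x - h = 0 by rewrite subr_eq0 => /eqP ->.
  apply: (@weight1_sum_eq0 s) => //; last by rewrite xE addrAC subrr add0r.
  apply: weightD => //; have := wH Hh.
  by rewrite /weight mulrN => ->; rewrite mulNr scalerN.
have H0 := subring0 HR.
(* Serves [V] with [b = a] and [W] with [b = a^-1]: degree 0 goes into [h], a positive degree into a
   one-entry list. *)
have pow S b (wS : forall x, S x -> weight b x)
    (bX : forall d, (0 < d)%N -> b ^+ d != 1) d y :
    powH H S d y -> exists h (s : seq (F * A)),
    [/\ H h, y = h + \sum_(p <- s) p.2 &
        forall p, p \in s -> p.1 != 1 /\ weight p.1 p.2].
  case: d => [Hy|d dy]; first by exists y, [::]; split; rewrite ?big_nil ?addr0.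
  exists 0, [:: (b ^+ d.+1, y)]; split; rewrite ?big_seq1 ?add0r // => p.
  by rewrite inE => /eqP -> /=; split; [exact: bX|exact: weight_powH dy].
elim: {wx} gx
  => [|{}x y _ [h [s [Hh -> ws]]] _ [h' [s' [Hh' -> ws']]]|d {}x|d {}x].
- by exists 0, [::]; rewrite big_nil addr0.
- exists (h + h'), (s ++ s'); split; first exact: (subringD HR).
    by rewrite big_cat /= addrACA.
  by move=> p; rewrite mem_cat => /orP[/ws|/ws'].
- exact: pow wV aX d x.
- apply: pow wW _ d x => d d0.
  by rewrite exprVn invr_eq1; exact: aX.
Qed.

End Weights.

(** * Subalgebras of a presented algebra *)

Section Subalgebras.
Variables (F : fieldType) (G : Type) (r : ncexpr F G -> ncexpr F G -> Prop).
Local Notation A := (palg r).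
Implicit Types (B S : set A).

Lemma subalg_genP B : is_subalg (subalg_gen B).
Proof.
split=> [S [[]]//|a x y Bx By S SB|x y Bx By S SB].
  by have [[_ SZ _] _] := SB; apply: SZ; [exact: Bx|exact: By].
by have [[_ _ SM] _] := SB; apply: SM; [exact: Bx|exact: By].
Qed.

Lemma subalg_gen_sub B x : B x -> subalg_gen B x.
Proof. by move=> Bx S [_]; apply. Qed.

Lemma subalg_gen_min B S x :
  is_subalg S -> (forall y, B y -> S y) -> subalg_gen B x -> S x.
Proof. by move=> SS BS; apply. Qed.

(** Links subalgebras over [F] with the ring arguments above, in which scalars appear as central
    elements. *)
Lemma is_subalgP S :
  is_subalg S <-> subring_set S /\ forall a : F, S (a *: (1 : A)).
Proof.
split=> [[S1 SZ SM]|[[S1 SD SN SM] SZ]].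
  have S0 : S 0 by rewrite -(addNr 1) -scaleN1r; exact: SZ.
  have SZ' a : S (a *: (1 : A)) by rewrite -[_ *: _]addr0; exact: SZ.
  split=> //; split=> // [x y Sx Sy|x Sx].
    by rewrite -[x]scale1r; exact: SZ.
  by rewrite -scaleN1r -[_ *: _]addr0; exact: SZ.
split=> // a x y Sx Sy; apply: SD => //.
by rewrite -[x]mul1r scale_palgAl; exact: SM.
Qed.

End Subalgebras.

(** * The presented algebra satisfies the abstract relations *)

Section DahaRelations.
Variables (R : realType) (M : nat) (q : R[i]).
Local Notation n := M.+2.
Local Notation A := (daha n q).

(** [inord] extends the families to all natural numbers, with a default value beyond the range; the
    relations concern indices within it. *)
Let t k : A := dahaT q (inord k : 'I_n.-1).
Let x i : A := dahaX q (inord i : 'I_n).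
Let xV i : A := dahaXV q (inord i : 'I_n).
Let y i : A := dahaY q (inord i : 'I_n).
Let yV i : A := dahaYV q (inord i : 'I_n).
Let tV k : A := dahaTV q (inord k : 'I_n.-1).
Let sc (a : Ctau R) : A := a *: (1 : A).

Lemma scalar_central a z : sc a * z = z * sc a.
Proof. by rewrite /sc -scale_palgAl -scale_palgAr mul1r mulr1. Qed.

Lemma scalarM a b : sc (a * b) = sc a * sc b.
Proof. by rewrite /sc -scale_palgAl mul1r scalerA. Qed.

Lemma dahaYtildeE : dahaYtilde n q = \prod_(j < M.+2) y j.
Proof. by apply: eq_bigr => j _; rewrite /y inord_val. Qed.

Lemma daha_relationsP : q != 0 ->
  daha_relations M.+1 (sc (tau R - (tau R)^-1)) (sc (qC q)) (sc (qC q)^-1)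
    t tV x xV y yV.
Proof.
move=> q0; have qC0 : qC q != 0 by rewrite tofrac_eq0 polyC_eq0.
have pr (s s' : ncexpr (Ctau R) (daha_gen n)) :
  daha_rel q s s' -> pi_palg (daha_rel q) s = pi_palg (daha_rel q) s'.
  exact: palg_relP.
have val k : (k < M.+1)%N -> (inord k : 'I_M.+1) = k :> nat.
  by move=> kM; rewrite inordK.
have val' k : (k <= M.+1)%N -> (inord k : 'I_M.+2) = k :> nat.
  by move=> kM; rewrite inordK.
split.
- exact: scalar_central.
- exact: scalar_central.
- exact: scalar_central.
- by rewrite -scalarM divff // /sc scale1r.
- by move=> k _; exact: dahaTTV.
- by move=> k _; exact: dahaTVT.
- by [].
- move=> k kN.
  have := pr _ _ (@dr_TXT R n q (inord k) (inord k) (inord k.+1) _ _).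
  rewrite !pi_palgM; apply.
    by rewrite val // val' // ltnW.
  by rewrite val // val'.
- move=> k i kN iN ik ik1.
  have := pr _ _ (@dr_TX R n q (inord k) (inord i) _ _).
  by rewrite !pi_palgM; apply; rewrite val // val' //; apply/eqP.
- move=> i _; have := pr _ _ (@dr_XXV R n q (inord i)).
  by rewrite pi_palgM pi_palgC scale1r.
- move=> i _; have := pr _ _ (@dr_XVX R n q (inord i)).
  by rewrite pi_palgM pi_palgC scale1r.
- move=> i j _ _; have := pr _ _ (@dr_XX R n q (inord i) (inord j)).
  by rewrite !pi_palgM.
(* The presentation has $T_k^{-1}Y_kT_k^{-1}=Y_{k+1}$; multiplication by $T_k$ on both sides gives
   [TYT]. *)
- move=> k kN.
  have := pr _ _ (@dr_TYT R n q (inord k) (inord k) (inord k.+1) _ _).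
  rewrite !pi_palgM !pi_palgB pi_palgC => e.
  have {e} : tV k * y k * tV k = y k.+1.
    apply: e; first by rewrite val // val' // ltnW.
    by rewrite val // val'.
  by move=> <-; rewrite !mulrA dahaTTV mul1r -mulrA dahaTVT mulr1.
- move=> k i kN iN ik ik1.
  have := pr _ _ (@dr_TY R n q (inord k) (inord i) _ _).
  by rewrite !pi_palgM; apply; rewrite val // val' //; apply/eqP.
- move=> i _; have := pr _ _ (@dr_YYV R n q (inord i)).
  by rewrite pi_palgM pi_palgC scale1r.
- move=> i _; have := pr _ _ (@dr_YVY R n q (inord i)).
  by rewrite pi_palgM pi_palgC scale1r.
- move=> i j _ _; have := pr _ _ (@dr_YY R n q (inord i) (inord j)).
  by rewrite !pi_palgM.
- move=> i _; have := pr _ _ (@dr_YprodX R n q (inord i)).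
  rewrite !pi_palgM pi_palgC -dahaYtildeE.
  rewrite (big_morph (pi_palg (daha_rel q)) (@pi_palgM _ _ _) (pi_palgC _ 1)).
  by rewrite scale1r.
- have := pr _ _ (@dr_YXYX R n q (inord 0) (inord 0) (inord 1) _ _ _).
  rewrite !pi_palgM => e.
  have {e} : yV 1 * x 0 * y 1 * xV 0 = t 0 * t 0 by apply: e; rewrite inordK.
  (* Multiplying by [y 1] on the left and [x 0] on the right clears the inverses. *)
  move=> e; have := congr1 (fun z => y 1 * z * x 0) e.
  have xK : xV 0 * x 0 = 1.
    have := pr _ _ (@dr_XVX R n q (inord 0)).
    by rewrite pi_palgM pi_palgC scale1r.
  have yK : y 1 * yV 1 = 1.
    have := pr _ _ (@dr_YYV R n q (inord 1)).
    by rewrite pi_palgM pi_palgC scale1r.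
  by rewrite !mulrA yK mul1r -(mulrA _ (xV 0)) xK mulr1.
Qed.

End DahaRelations.

(** * The grading of [frakA] and the centraliser of [dahaYtilde] *)

Section Centralisers.
Variables (R : realType) (M : nat) (q : R[i]).
Local Notation n := M.+2.
Local Notation A := (daha n q).
Hypotheses (q0 : q != 0) (qX : forall m, (0 < m)%N -> q ^+ m != 1).

Let t k : A := dahaT q (inord k : 'I_n.-1).
Let x i : A := dahaX q (inord i : 'I_n).
Let xV i : A := dahaXV q (inord i : 'I_n).
Let y i : A := dahaY q (inord i : 'I_n).
Let yV i : A := dahaYV q (inord i : 'I_n).
Let sc (a : Ctau R) : A := a *: (1 : A).
Let rel := daha_relationsP M q0.
Let s := sc (qC q - (qC q)^-1)^-1.

Let K : set A := subalg_gen
  (range (@dahaT R n q) `|` range (@dahaY R n q) `|` range (@dahaYV R n q)).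
Let V : set A := KX M x K.
Let W : set A := KDK M xV y yV K s.
Let H : set A := Hgl n q.

Let KR : subring_set K.
Proof. exact: ((is_subalgP _).1 (subalg_genP _)).1. Qed.

Let Ksc a : K (sc a).
Proof. exact: ((is_subalgP _).1 (subalg_genP _)).2. Qed.

Let KdT k : K (dahaT q k).
Proof. by apply: subalg_gen_sub; left; left; exists k. Qed.

Let KdY i : K (dahaY q i).
Proof. by apply: subalg_gen_sub; left; right; exists i. Qed.

Let KdYV i : K (dahaYV q i).
Proof. by apply: subalg_gen_sub; right; exists i. Qed.

Let Z : set A := range sc.

Let ZC z a : Z z -> z * a = a * z.
Proof. by case=> b _ <-; exact: scalar_central. Qed.

Let ZK z : Z z -> K z.
Proof. by case=> b _ <-. Qed.

Let K_ind (P : set A) : subring_set P -> (forall z, Z z -> P z) ->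
  (forall k, (k < M.+1)%N -> P (t k)) -> (forall z, Yset M y yV z -> P z) ->
  forall h, K h -> P h.
Proof.
move=> PR PZ PT PY h; apply: subalg_gen_min.
  by apply/is_subalgP; split=> // a; apply: PZ; exists a.
move=> _ [[[k _ <-]|[i _ <-]]|[i _ <-]].
- by have := PT k (ltn_ord k); rewrite /t inord_val.
- apply: PY; exists i; first by rewrite -ltnS ltn_ord.
  by left; rewrite /y inord_val.
- apply: PY; exists i; first by rewrite -ltnS ltn_ord.
  by right; rewrite /yV inord_val.
Qed.

Let HR : subring_set H.
Proof. exact: ((is_subalgP _).1 (subalg_genP _)).1. Qed.

Let KH a : K a -> H a.
Proof.
apply: subalg_gen_min; first exact: subalg_genP.
move=> _ [[[k _ <-]|[i _ <-]]|[i _ <-]]; apply: subalg_gen_sub; left.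
- by left; left; exists k.
- by left; right; exists i.
- by right; exists i.
Qed.

Let D : A := s * (xV M.+1 * (y M.+1 - yV M.+1)).

Let dahaDlastE i : dahaDlast q (last_ord i) = D.
Proof.
have -> : last_ord i = inord M.+1 :> 'I_n.
  by apply/val_inj; rewrite /= last_ordE inordK.
by rewrite /D /s /sc -scale_palgAl mul1r.
Qed.

Let dahaD_last : dahaD q (inord M.+1) = D.
Proof.
rewrite /dahaD dahaDlastE !big_pred0 ?mulr1 ?mul1r // => k.
  by apply/negbTE; rewrite -ltnNge inordK //; exact: (ltn_ord (rev_ord k)).
by apply/negbTE; rewrite -ltnNge inordK //; exact: ltn_ord.
Qed.

Let WD i : W (dahaD q i).
Proof.
have Kprod (P : pred 'I_n.-1) (f : 'I_n.-1 -> 'I_n.-1) :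
    K (\prod_(k < n.-1 | P k) (@dahaT R n q (f k) : A)).
  elim/big_ind: _ => [|a b|k _]; [exact: subring1 KR|exact: (subringM KR)|].
  exact: KdT.
rewrite /dahaD dahaDlastE.
apply: (KDK_Kr KR); first exact: Kprod.
by apply: (KDK_Kl KR); [exact: (Kprod _ id)|exact: KDK_D].
Qed.

Let VX i : V (dahaX q i).
Proof.
by have := KX_X x KR (ltn_ord i : i <= M.+1)%N; rewrite /x inord_val.
Qed.

Let YtV_ex := Yprod_inv rel.
Let wt := weight (r := @daha_rel R n q) (dahaYtilde n q).

Let VWH v w : V v -> W w -> H (v * w).
Proof.
have [YtV [YtK YtVK]] := YtV_ex.
apply: (KX_KDK_closed rel KR (Ksc _) (Ksc _) (Ksc _) (fun k _ => KdT _)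
  (fun i _ => KdY _) (fun i _ => KdYV _) YtK YtVK ZC ZK K_ind
  (scalar_central _) (Ksc _)).
- exact: (subringD HR).
- by move=> h z /KH; exact: (subringM HR).
- by move=> h z /KH Hh Hz; exact: (subringM HR).
- exact: KH.
(* [x 0 * D] is the generator $e_{ij}$ with [i] first and [j] last; these differ as $n=M+2\ge2$. *)
apply: subalg_gen_sub; right; exists (inord 0), (inord M.+1).
by rewrite dahaD_last; split=> //; rewrite -val_eqE /= !inordK.
Qed.

Let VW v w : V v -> W w -> addset K (mulspan W V) (v * w).
Proof.
have [YtV [YtK YtVK]] := YtV_ex.
exact: (KX_KDK rel KR (Ksc _) (Ksc _) (Ksc _) (fun k _ => KdT _)
  (fun i _ => KdY _) (fun i _ => KdYV _) YtK YtVK ZC ZK K_ind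
  (scalar_central _) (Ksc _)).
Qed.

Let WV v w : V v -> W w -> addset K (mulspan V W) (w * v).
Proof.
have [YtV [YtK YtVK]] := YtV_ex.
exact: (KDK_KX rel KR (Ksc _) (Ksc _) (Ksc _) (fun k _ => KdT _)
  (fun i _ => KdY _) (fun i _ => KdYV _) YtK YtVK ZC ZK K_ind
  (scalar_central _) (Ksc _)).
Qed.

Let H_ind (P : set A) : subring_set P -> (forall a, K a -> P a) ->
  (forall v w, V v -> W w -> P (v * w)) -> forall h, H h -> P h.
Proof.
move=> PR PK PVW h; apply: subalg_gen_min.
  by apply/is_subalgP; split=> // a; apply: PK; exact: Ksc.
move=> _ [[[[k _ <-]|[i _ <-]]|[i _ <-]]|[i [j [_ ->]]]].
- by apply: PK; exact: KdT.
- by apply: PK; exact: KdY.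
- by apply: PK; exact: KdYV.
- by apply: PVW; [exact: VX|exact: WD].
Qed.

(** The left multipliers preserving [graded H V W] form a subalgebra containing the generators of
    [frakA]; applying them to 1 gives the claim. *)
Lemma frakA_graded a : frakA n q a -> graded H V W a.
Proof.
have V_Kl k v : K k -> V v -> V (k * v) by exact: KX_Kl.
have W_Kl k w : K k -> W w -> W (k * w) by exact: KDK_Kl.
suff gA : frakA n q a -> forall g, graded H V W g -> graded H V W (a * g).
  move=> /gA; rewrite -{2}[a]mulr1; apply.
  by apply: (@gradedV _ _ _ _ 0); exact: subring1 HR.
pose P := [set a : A | forall g, graded H V W g -> graded H V W (a * g)].
have Hl h : H h -> P h.
  by move=> Hh g; exact: (graded_Hl HR KH V_Kl W_Kl VW WV VWH H_ind).
apply: (@subalg_gen_min _ _ _ _ P).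
  apply/is_subalgP; split; first split.
  - by apply: Hl; exact: (subring1 HR).
  - by move=> b b' Pb Pb' g gg; rewrite mulrDl; apply: gradedD; auto.
  - move=> b Pb g gg; rewrite mulNr -mulrN; apply: Pb.
    rewrite -mulN1r; apply: (Hl (-1)) gg.
    by apply: (subringN HR); exact: (subring1 HR).
  - by move=> b b' Pb Pb' g gg; rewrite -mulrA; apply: Pb; exact: Pb'.
  - by move=> b; exact: (Hl _ (KH (Ksc b))).
move=> _ [[[[[i _ <-]|[i _ <-]]|[i _ <-]]|[i _ <-]]|[k _ <-]].
- by move=> g; exact: (graded_Vl HR KH V_Kl W_Kl VW WV VWH H_ind (VX i)).
- by move=> g; exact: (graded_Wl HR KH V_Kl W_Kl VW WV VWH H_ind (WD i)).
- exact: (Hl _ (KH (KdY i))).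
- exact: (Hl _ (KH (KdYV i))).
- exact: (Hl _ (KH (KdT k))).
Qed.

Let wX i : wt (qC q) (dahaX q i).
Proof.
have := YprodX rel (ltn_ord i : i <= M.+1)%N.
rewrite -dahaYtildeE inord_val => e; rewrite /wt /weight [LHS]e.
by rewrite -!scale_palgAl mul1r.
Qed.

Let qC0 : qC q != 0.
Proof. by rewrite tofrac_eq0 polyC_eq0. Qed.

Let wXV i : wt (qC q)^-1 (dahaXV q i).
Proof.
have iN : (i <= M.+1)%N by rewrite -ltnS ltn_ord.
apply: weightV (wX i) => //.
  by have := XXV rel iN; rewrite inord_val.
by have := XVX rel iN; rewrite inord_val.
Qed.

Let wK a : K a -> wt 1 a.
Proof.
apply: subalg_gen_min; first exact: weight1_subalg.
rewrite /wt /weight dahaYtildeE.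
move=> _ [[[k _ <-]|[i _ <-]]|[i _ <-]]; rewrite scale1r.
- by have := TYprod rel (ltn_ord k); rewrite inord_val.
- by have := YprodY rel (ltn_ord i : i <= M.+1)%N; rewrite inord_val.
- by have := YprodYV rel (ltn_ord i : i <= M.+1)%N; rewrite inord_val.
Qed.

Let wV v : V v -> wt (qC q) v.
Proof.
apply: mulspan_sub; [exact: weight0|exact: weightD|].
move=> k _ Kk [i _ ->]; rewrite -[qC q]mul1r.
by apply: weightM; [exact: wK|exact: wX].
Qed.

Let wW w : W w -> wt (qC q)^-1 w.
Proof.
have wD : wt (qC q)^-1 D.
  rewrite -[_^-1]mul1r; apply: weightM; first exact: (wK (Ksc _)).
  rewrite -[_^-1]mulr1; apply: weightM; first exact: wXV.
  by apply: wK; apply: (subringB KR); [exact: KdY|exact: KdYV].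
apply: mulspan_sub; [exact: weight0|exact: weightD|move=> a k + Kk].
rewrite -[_^-1]mulr1 => Da; apply: weightM; last exact: wK.
move: a Da; apply: mulspan_sub; [exact: weight0|exact: weightD|].
move=> h _ Kh ->.
by rewrite -[_^-1]mul1r; apply: weightM => //; exact: wK.
Qed.

Let wH h : H h -> wt 1 h.
Proof.
move: h; apply: H_ind => [||v w Vv Ww].
- exact: ((is_subalgP _).1 (weight1_subalg _)).1.
- exact: wK.
- by rewrite -(mulfV qC0); apply: weightM; [exact: wV|exact: wW].
Qed.

(** Constants embed injectively in $\mathbb{C}(\tau)$, so $q$ does not become a root of unity
    there. *)
Let qCX d : (0 < d)%N -> qC q ^+ d != 1.
Proof.
move=> d0; rewrite -tofracXn -polyC_exp -tofrac1 tofrac_eq -polyC1.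
by rewrite (inj_eq (@polyC_inj _)); exact: qX.
Qed.

Lemma Hgl_sub_frakA a : Hgl n q a -> frakA n q a.
Proof.
apply: subalg_gen_min; first exact: subalg_genP.
have [_ _ SM] : is_subalg (frakA n q) by exact: subalg_genP.
move=> _ [[[[k _ <-]|[i _ <-]]|[i _ <-]]|[i [j [_ ->]]]].
- by apply: subalg_gen_sub; right; exists k.
- by apply: subalg_gen_sub; left; left; right; exists i.
- by apply: subalg_gen_sub; left; right; exists i.
apply: SM; apply: subalg_gen_sub; left; left; left; [left|right].
  by exists i.
by exists j.
Qed.

Lemma dahaYtilde_Hgl : Hgl n q (dahaYtilde n q).
Proof.
rewrite /dahaYtilde; elim/big_ind: _ => [|a b|i _].
- exact: subring1 HR.
- exact: (subringM HR).
- by apply: KH; exact: KdY.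
Qed.

(** Commuting with [dahaYtilde] means having weight 1, which within the graded sum forces membership
    in [Hgl]; conversely the weights $q$ and $q^{-1}$ of $X_i$ and $D_j$ cancel in $e_{ij}$. *)
Lemma centraliser_dahaYtilde :
  centraliser (frakA n q) [set dahaYtilde n q] = Hgl n q.
Proof.
have [YtV [YtK _]] := YtV_ex; rewrite -dahaYtildeE in YtK.
rewrite eqEsubset; split=> [a [Aa aY]|a Ha].
  apply: (weight1_graded YtK HR wH wV wW qCX); first exact: frakA_graded.
  by rewrite /weight scale1r aY.
split; first exact: Hgl_sub_frakA.
by move=> _ ->; have := wH Ha; rewrite /wt /weight scale1r.
Qed.

End Centralisers.

Unset Implicit Arguments.

Theorem theorem5p10 (R : realType) (n : nat) (q : R[i])
    (hn : (2 <= n)%N) (hq0 : q != 0)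
    (hq : forall m : nat, (0 < m)%N -> q ^+ m != 1) :
  centraliser (frakA n q) [set dahaYtilde n q] = Hgl n q /\
  centraliser (frakA n q) (Hgl n q) = centre (Hgl n q).
Proof.
case: n hn => [|[|M]] // _.
have CY := centraliser_dahaYtilde M hq0 hq; split=> //.
rewrite eqEsubset; split=> a [Ha aH]; split=> //.
  by rewrite -CY; split=> // _ ->; apply: aH; exact: dahaYtilde_Hgl.
exact: Hgl_sub_frakA.
Qed.
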